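(* Consider the parking process on $\mathbb{Z}$ with $p=1/2$, and let $\tau$ be the parking time of the car starting at $0$ (with $\tau=0$ if $0$ is initially a parking space). There exist constants $C,c>0$ such that for all integers $t\ge 2$, $$c\,t^{3/4}(\log t)^{-1/4}\;\le\;\mathbb{E}[\min\{\tau,t\}]\;\le\; C\,t^{3/4}.$$
   Context: The parking process on $\mathbb{Z}$ with parameter $p$. Independently for each $v\in\mathbb{Z}$ let: $X^v=(X^v_0,X^v_1,\dots)$ be a simple symmetric random walk on $\mathbb{Z}$ with $X^v_0=v$ (steps $\pm1$ with probability $1/2$ each); $(U^v_s)_{s\in\mathbb{N}}$ be i.i.d. uniform random variables on $[0,1]$; $B^v$ be a Bernoulli($p$) random variable; all of these are independent. At time $0$ there is a car at $v$ if $B^v=1$, and otherwise $v$ is a parking space with capacity for one car. The car starting at $v$ follows the walk $X^v$ (all cars moving simultaneously at times $1,2,\dots$) until it arrives at a free parking space, where it parks permanently. If several cars arrive at the same free parking space at time $s$, the car $u$ among them with the smallest $U^u_s$ parks there and the others continue. Let $\tau^v=0$ if $v$ is initially a parking space; otherwise $\tau^v$ is the time at which the car starting at $v$ parks ($\tau^v=\infty$ if it never parks). Write $\tau=\tau^0$. *)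

(* Defs.v *)
From HB Require Import structures.
From mathcomp Require Import all_boot all_order all_algebra finmap.
From mathcomp Require Import all_classical all_reals all_analysis.

Set Implicit Arguments.
Unset Strict Implicit.
Unset Printing Implicit Defensive.

Import Order.TTheory GRing.Theory Num.Theory.
Import numFieldNormedType.Exports.

Local Open Scope classical_set_scope.
Local Open Scope ring_scope.

(* Mutual independence of a family of sets of events; with
   [F i := generated_events (X i)] below it is the mutual independence of the
   random variables [X i], which may have different codomains. *)
Definition mutually_independent (d : measure_display) (T : measurableType d)
    (R : realType) (P : probability T R) (I : choiceType)
    (F : I -> set (set T)) : Prop :=
  forall (J : {fset I}) (A : I -> set T), (forall i, i \in J -> F i (A i)) ->
    P (\bigcap_(i in [set` J]) A i) = (\prod_(i <- J) P (A i))%E.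

Definition generated_events (d d' : measure_display) (T : measurableType d)
    (T' : measurableType d') (X : T -> T') : set (set T) :=
  preimage_set_system [set: T] X measurable.

(* Index of all the sources of randomness: [inl (inl v)] for B^v,
   [inl (inr (v, n))] for the (n+1)-st step of X^v, [inr (v, s)] for U^v_s. *)
Definition source : choiceType := (int + int * nat + int * nat)%type.

Definition source_events (d : measure_display) (T : measurableType d)
    (R : realType) (B : int -> T -> bool) (xi : int -> nat -> T -> bool)
    (U : int -> nat -> T -> R) (k : source) : set (set T) :=
  match k with
  | inl (inl v) => generated_events (B v)
  | inl (inr vn) => generated_events (xi vn.1 vn.2)
  | inr vs => generated_events (U vs.1 vs.2)
  end.

(* [heads v n] is the fair coin deciding whether the (n+1)-st step of the walk
   X^v is +1 or -1. The laws are compared on measurable sets only, because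
   [uniform_prob] is a junk value elsewhere. *)
Record parking_randomness (d : measure_display) (T : measurableType d)
    (R : realType) (P : probability T R) (p : R) := ParkingRandomness {
  car : int -> {RV P >-> bool} ;
  heads : int -> nat -> {RV P >-> bool} ;
  prio : int -> nat -> {RV P >-> R} ;
  car_law : forall v (A : set bool), measurable A ->
    distribution P (car v) A = bernoulli_prob p A ;
  heads_law : forall v n (A : set bool), measurable A ->
    distribution P (heads v n) A = bernoulli_prob 2^-1 A ;
  prio_law : forall v s (A : set R), measurable A ->
    distribution P (prio v s) A = uniform_prob (@ltr01 R) A ;
  all_independent : mutually_independent P
    (source_events (fun v => car v) (fun v n => heads v n)
                   (fun v s => prio v s)) }.

(* The dynamics for a fixed realization: [b v] iff a car starts at [v],
   [x v s] is the position of the walk X^v at time [s], [u v s] is U^v_s. *)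
Section Dynamics.
Variables (R : realType) (b : int -> bool).
Variables (x : int -> nat -> int) (u : int -> nat -> R).

(* The cars that park at time [s], given the cars still driving and the spaces
   still free just before. The inequality is strict, so that nobody parks in
   case of a tie, an event of probability zero. *)
Definition parkers (driving free : set int) (s : nat) : set int :=
  [set v | [/\ driving v, free (x v s) &
    forall w, driving w -> w != v -> x w s = x v s -> u v s < u w s]].

(* The set of driving cars, named by their starting points, and the set of free
   parking spaces, after the moves of time [n]. *)
Fixpoint state (n : nat) : set int * set int :=
  if n is m.+1 then
    let: (driving, free) := state m in
    let N := parkers driving free m.+1 in
    (driving `\` N, free `\` [set x v m.+1 | v in N])
  else ([set v | b v], [set v | ~~ b v]).

Definition parks_at (v : int) (s : nat) : Prop :=
  exists2 m, s = m.+1 & parkers (state m).1 (state m).2 m.+1 v.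

(* A car parks at most once, so the infimum is over at most one time, and it
   is +oo when the car never parks. *)
Definition parking_time (v : int) : \bar R :=
  if b v then ereal_inf [set s%:R%:E | s in [set s | parks_at v s]] else 0%E.

End Dynamics.

Definition walk (d : measure_display) (T : measurableType d) (R : realType)
    (P : probability T R) (p : R) (D : parking_randomness P p)
    (w : T) (v : int) (n : nat) : int :=
  v + \sum_(i < n) (if heads D v i w then 1 else -1).

Definition tau (d : measure_display) (T : measurableType d) (R : realType)
    (P : probability T R) (p : R) (D : parking_randomness P p)
    (v : int) (w : T) : \bar R :=
  parking_time (fun y => car D y w) (walk D w) (fun y s => prio D y s w) v.

(* Main.v *)
(* The car starting at v survives time s with probability q(s), independent of
   v, and E[min(tau, t)] = q(0) + ... + q(t-1); both bounds come from
   q(s) ~ s^(-1/4).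

   Upper bound. Let H_n(d) = O(d sqrt n) be the expectation of min(T, n), T being
   the time a random walk from distance d needs to hit its target. H_n is
   subadditive in d. Assign to the driving cars distinct free spaces; if a car
   parks in the space assigned to another one, the latter inherits the space of
   the former, and by the triangle inequality the sum of the H_n of the distances
   to the assigned spaces does not grow. Hence the total driving time up to t is
   at most the sum of the initial H_t. Matching cars and spaces like brackets, the
   distance from a car to its space is the first return time of a random walk, so
   the mean cost of a car is O(sqrt t) times the mean of that time truncated at
   sqrt t, which is O(t^(1/4)).

   Lower bound. Of the cars starting in an interval of length n, at least (cars -
   spaces) minus the number of cars leaving the interval survive. The first term
   has a positive part of mean at least sqrt n / 8. The second has mean at most
   twice the mean of the maximal displacement of a car before it parks, which is
   O(1 + sum of q(s) / sqrt(s+1)) = O(t^(1/4)) by the upper bound. Taking n to be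
   a large multiple of sqrt t gives n q(t) >= c t^(1/4), so the logarithm in the
   statement is not needed. *)

Require Import Defs.
From HB Require Import structures.
From mathcomp Require Import all_boot all_order all_algebra finmap.
From mathcomp Require Import all_classical all_reals all_analysis.
From mathcomp Require Import measurable_realfun zify ring lra.

Set Implicit Arguments.
Unset Strict Implicit.
Unset Printing Implicit Defensive.

Import Order.TTheory GRing.Theory Num.Theory.
Import numFieldNormedType.Exports.

Local Open Scope classical_set_scope.
Local Open Scope ring_scope.

(** * Hitting times of simple random walk *)

Section HittingTime.
Variable R : realType.

(* E[min(T, n)] for the time T at which simple random walk from d hits 0. *)
Fixpoint hit (n d : nat) : R :=
  if n is n'.+1 then
    if d is d'.+1 then 1 + (hit n' d' + hit n' d'.+2) / 2 else 0
  else 0.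

Lemma hit0 n : hit n 0 = 0. Proof. by case: n. Qed.

Lemma hitS n d : hit n.+1 d.+1 = 1 + (hit n d + hit n d.+2) / 2.
Proof. by []. Qed.

Lemma hit_ge0 n d : 0 <= hit n d.
Proof.
elim: n d => [//|n IHn] [|d]; first by rewrite hit0.
by rewrite hitS addr_ge0 // divr_ge0 // addr_ge0.
Qed.

Lemma hit_le_time n d : hit n d <= n%:R.
Proof.
elim: n d => [//|n IHn] [|d]; first by rewrite hit0.
rewrite hitS -[n.+1%:R]natr1; have := IHn d; have := IHn d.+2; lra.
Qed.

Lemma le_hit_time n d : hit n d <= hit n.+1 d.
Proof.
elim: n d => [|n IHn] [|d]; first by rewrite !hit0.
- exact: hit_ge0.
- by rewrite !hit0.
rewrite [leRHS]hitS [leLHS]hitS; have := IHn d; have := IHn d.+2; lra.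
Qed.

Lemma le_hitS n d : hit n d <= hit n d.+1.
Proof.
elim: n d => [//|n IHn] [|d]; first by rewrite hit0 hit_ge0.
rewrite !hitS; have := IHn d; have := IHn d.+2; lra.
Qed.

Lemma le_hit n d e : (d <= e)%N -> hit n d <= hit n e.
Proof.
move=> /subnK <-; elim: (e - d)%N => [//|k IHk].
by rewrite addSn; apply: le_trans IHk (le_hitS _ _).
Qed.

(** A walk started at [d + e] first descends to [e] and then to 0; truncating each stage at [n]
    separately only increases the sum. *)
Lemma hit_subadd n d e : hit n (d + e) <= hit n d + hit n e.
Proof.
elim: n d e => [|n IHn] d e; first by rewrite addr0.
case: d => [|d]; first by rewrite add0n hit0 add0r.
rewrite addSn !hitS.
have := IHn d e; have := IHn d.+2 e; have := le_hit_time n e.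
rewrite !addSn; lra.
Qed.

(* Stopping the walk also at [l] gives [d (l - d)] for the expected exit time
   and [d / l] for the probability of reaching [l] first. *)
Lemma hit_le_gambler n l d : (d <= l)%N -> (0 < l)%N ->
  hit n d <= d%:R * (l%:R - d%:R) + d%:R / l%:R * n%:R.
Proof.
move=> + l0; have l0' : 0 < l%:R :> R by rewrite ltr0n.
elim: n d => [|n IHn] d dl.
  by rewrite mulr0 addr0 mulr_ge0 // subr_ge0 ler_nat.
case: d dl => [|d] dl; first by rewrite hit0 !mul0r addr0.
move: dl; rewrite leq_eqVlt => /orP[/eqP ->|dl].
  rewrite subrr mulr0 add0r divff ?gt_eqF // mul1r; exact: hit_le_time.
rewrite hitS; have := IHn d (ltnW (ltnW dl)); have := IHn d.+2 dl.
rewrite -[d.+2%:R]natr1 -[d.+1%:R]natr1 -[n.+1%:R]natr1.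
set a := d%:R; set b := n%:R; set c := l%:R => h1 h2.
have h3 : (a + 1) / c * b <= (a + 1) / c * (b + 1).
  by rewrite ler_wpM2l ?divr_ge0 ?addr_ge0 ?ler0n // lerDl.
apply: le_trans (_ : 1 + (a * (c - a) + a / c * b +
  ((a + 1 + 1) * (c - (a + 1 + 1)) + (a + 1 + 1) / c * b)) / 2 <= _); first lra.
have -> : 1 + (a * (c - a) + a / c * b +
  ((a + 1 + 1) * (c - (a + 1 + 1)) + (a + 1 + 1) / c * b)) / 2
  = (a + 1) * (c - (a + 1)) + (a + 1) / c * b by field; rewrite gt_eqF.
by rewrite lerD2l.
Qed.

(** For [d <= l] both terms of the gambler's ruin bound are at most [d l]; for [d > l] the trivial
    bound [n <= l^2] is enough. *)
Lemma hit_le_sqrt n l d : (n <= l ^ 2)%N -> hit n d <= 2 * d%:R * l%:R.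
Proof.
move=> nl; case: (posnP l) => [l0|l0].
  by move: nl; rewrite l0 leqn0 => /eqP ->; rewrite mulr0.
have [dl|ld] := leqP d l.
  apply: (le_trans (hit_le_gambler n dl l0)).
  have h : d%:R / l%:R * n%:R <= d%:R * l%:R :> R.
    rewrite -mulrA ler_wpM2l ?ler0n // mulrC ler_pdivrMr ?ltr0n //.
    by rewrite -natrM ler_nat.
  have : 0 <= d%:R * d%:R :> R by rewrite mulr_ge0.
  move: h; lra.
apply: (le_trans (hit_le_time n d)).
rewrite -!natrM ler_nat; move: nl ld; nia.
Qed.

End HittingTime.

(** * Deterministic dynamics *)

Section Reassignment.
Variable R : realType.

(* When [j] in [Ps] parks in the space assigned to [i], the space of [j] goes to
   [i]. *)
Lemma reassign (c : int -> option int -> R) (x : int -> int) :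
    (forall v o, 0 <= c v o) ->
    (forall i j o, c (x i) o <= c (x i) (Some (x j)) + c (x j) o) ->
  forall (Ps L : seq int) (y : int -> option int), uniq (Ps ++ L) ->
    {in Ps ++ L &, forall v v', y v -> y v = y v' -> v = v'} ->
  exists y' : int -> option int,
    [/\ {in L &, forall v v', y' v -> y' v = y' v' -> v = v'},
        {in L, forall v z, y' v = Some z ->
           z \notin map x Ps /\ exists2 v', v' \in Ps ++ L & y v' = Some z} &
        \sum_(v <- L) c (x v) (y' v) <= \sum_(v <- Ps ++ L) c (x v) (y v)].
Proof.
move=> c0 ctri; elim=> [|j Ps IHPs] L y /=.
  by move=> _ yinj; exists y; split=> // v vL z yz; split=> //; exists v.
set A := Ps ++ L => /andP[jA uA] yinj.
(* The parking cars are handled one at a time: [y1] is the assignment once [j] has taken its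
   space. *)
suff [y1 [y1inj y1old y1c]] : exists y1 : int -> option int,
    [/\ {in A &, forall v v', y1 v -> y1 v = y1 v' -> v = v'},
        {in A, forall v z, y1 v = Some z ->
           z != x j /\ exists2 v', v' \in j :: A & y v' = Some z} &
        \sum_(v <- A) c (x v) (y1 v) <= \sum_(v <- j :: A) c (x v) (y v)].
  have [y' [y'inj y'old y'c]] := IHPs L y1 uA y1inj.
  exists y'; split=> //; last exact: le_trans y'c y1c.
  move=> v vL z y'z; have [zPs [v' v'A y1z]] := y'old v vL z y'z.
  have [zj ex] := y1old v' v'A z y1z.
  by split; rewrite // inE negb_or zj zPs.
have [/hasP[i iA /eqP yi]|/hasPn noi] := boolP (has (fun i => y i == Some (x j)) A).
  have ij : i != j by apply: contraNneq jA => <-.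
  exists (fun v => if v == i then y j else y v); split.
  - move=> v v' vA v'A; have vj : v \in j :: A by rewrite inE vA orbT.
    have v'j : v' \in j :: A by rewrite inE v'A orbT.
    have jj : j \in j :: A by rewrite inE eqxx.
    case: (eqVneq v i) => [->|vi]; case: (eqVneq v' i) => [->|v'i] // Yv Yvv'.
    + by move: jA; rewrite (yinj _ _ jj v'j Yv Yvv') v'A.
    + by move: jA; rewrite -(yinj _ _ vj jj Yv Yvv') vA.
    + exact: yinj vj v'j Yv Yvv'.
  - move=> v vA z; case: (eqVneq v i) => [_|vi] yz.
      split; last by exists j => //; rewrite inE eqxx.
      apply: contra_neq ij => zx.
      apply: (yinj i j); rewrite ?inE ?eqxx ?iA ?orbT //; first by rewrite yi.
      by rewrite yi yz zx.
    split; last by exists v => //; rewrite inE vA orbT.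
    apply: contra_neq vi => zx.
    apply: (yinj v i); rewrite ?inE ?vA ?iA ?orbT //; first by rewrite yz.
    by rewrite yi yz zx.
  - rewrite big_cons (bigD1_seq i) //= eqxx.
    rewrite [in leRHS](bigD1_seq i) //= [in leRHS]yi addrA.
    apply: lerD; first by rewrite addrC; exact: ctri.
    by apply: ler_sum => v /negPf ->.
exists y; split.
- by move=> v v' vA v'A; apply: yinj; rewrite inE ?vA ?v'A orbT.
- move=> v vA z yz; split; last by exists v => //; rewrite inE vA orbT.
  by apply: contra (noi v vA) => /eqP <-; rewrite yz.
- by rewrite big_cons lerDr.
Qed.

End Reassignment.

Section Dynamics.
Variables (R : realType) (b : int -> bool).
Variables (x : int -> nat -> int) (u : int -> nat -> R).

Local Notation D n := (state b x u n).1.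
Local Notation F n := (state b x u n).2.
Local Notation N n := (parkers x u (D n) (F n) n.+1).

Lemma drivingS n v : D n.+1 v <-> D n v /\ ~ N n v.
Proof. by rewrite /=; case: (state b x u n). Qed.

Lemma freeS n y : F n.+1 y <-> F n y /\ forall v, N n v -> x v n.+1 <> y.
Proof.
rewrite /=; case: (state b x u n) => dr fr /=; split=> -[Fy h]; split=> //.
  by move=> v Nv xy; apply: h; exists v.
by case=> v Nv; exact: h.
Qed.

Lemma driving_le m n v : (m <= n)%N -> D n v -> D m v.
Proof.
move=> /subnK <-; elim: (n - m)%N => [//|k IHk].
by rewrite addSn => /drivingS[/IHk].
Qed.

Lemma free_le m n y : (m <= n)%N -> F n y -> F m y.
Proof.
move=> /subnK <-; elim: (n - m)%N => [//|k IHk].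
by rewrite addSn => /freeS[/IHk].
Qed.

Lemma driving_car n v : D n v -> b v.
Proof. by move=> /(driving_le (leq0n n)). Qed.

Lemma free_space n y : F n y -> ~~ b y.
Proof. by move=> /(free_le (leq0n n)). Qed.

Lemma parkers_inj n v w : N n v -> N n w -> x v n.+1 = x w n.+1 -> v = w.
Proof.
move=> [Dv Fv hv] [Dw Fw hw] e; apply/eqP/negP => /negP vw.
have := hv w Dw; rewrite eq_sym => /(_ vw (esym e)).
have := hw v Dv vw e; lra.
Qed.

Hypothesis step1 : forall v n, `|x v n - v| <= n%:Z.

(* Only finitely many cars can be at a given site, so without ties one of them
   has the smallest priority. *)
Lemma parker_exists n v : (forall s v w, v != w -> u v s != u w s) ->
  D n v -> F n (x v n.+1) -> exists2 w, N n w & x w n.+1 = x v n.+1.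
Proof.
move=> tie Dv Fv; set z := x v n.+1.
(* [c] lists the [2(n+1)+1] sites within distance [n+1] of [z]; by [step1] no other car can be at
   [z] at time [n+1]. *)
pose c (i : 'I_(n.+1.*2.+1)) : int := z - n.+1%:Z + (i : nat)%:Z.
have cP w : x w n.+1 = z -> exists i, c i = w.
  move=> xw; have := step1 w n.+1; rewrite xw => h.
  have h1 : (absz (w - (z - n.+1%:Z))%R < n.+1.*2.+1)%N by lia.
  exists (Ordinal h1); rewrite /c /=; lia.
pose Q i := `[< D n (c i) /\ x (c i) n.+1 = z >].
have [i0 ci0] := cP v erefl.
have Qi0 : Q i0 by apply/asboolP; rewrite ci0.
pose i := [arg min_(j < i0 | Q j) u (c j) n.+1]%O.
have [/asboolP[Di xi] imin] : Q i /\ forall j, Q j -> u (c i) n.+1 <= u (c j) n.+1.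
  by rewrite /i; case: arg_minP.
exists (c i) => //; split=> //; first by rewrite xi.
move=> w Dw wi; rewrite xi => xw; have [j cj] := cP w xw.
rewrite lt_neqAle tie 1?eq_sym // -cj; apply: imin.
by apply/asboolP; rewrite cj.
Qed.

(** If a driver stepped on a free space, [parker_exists] would supply a car that occupies it in the
    same step. Hence a driving car is never already on the free space assigned to it. *)
Lemma driving_not_free n v : (forall s v w, v != w -> u v s != u w s) ->
  D n v -> ~ F n (x v n).
Proof.
move=> tie; case: n => [|n].
  move=> Dv Fv; have := step1 v 0; rewrite normr_le0 subr_eq0 => /eqP e.
  by move: Fv; rewrite e => /free_space; rewrite (driving_car Dv).
move=> /drivingS[Dv nN] /freeS[Fv h].
by have [w Nw xw] := parker_exists tie Dv Fv; exact: h w Nw xw.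
Qed.

End Dynamics.

Lemma eq_state (R : realType) b x x' (u : int -> nat -> R) n :
  (forall v m, (m <= n)%N -> x v m = x' v m) -> state b x u n = state b x' u n.
Proof.
elim: n => [//|n IHn] e /=; rewrite -IHn; last by move=> v m mn; rewrite e // ltnW.
case: (state b x u n) => dr fr.
suff -> : parkers x' u dr fr n.+1 = parkers x u dr fr n.+1.
  by congr (_, _ `\` _); rewrite seteqP; split=> y [v Nv <-]; exists v => //; rewrite e.
rewrite seteqP; split=> v [Dv Fv h]; split=> //; rewrite ?e // -?e // => w Dw wv.
  by rewrite !e //; exact: h.
by rewrite -!e //; exact: h.
Qed.

(** * Averaging over bits *)

Record config (R : Type) := Config {
  cars : int -> bool ;
  coins : int -> nat -> bool ;
  prios : int -> nat -> R }.

Section Averaging.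
Variable R : realType.
Implicit Types (w : config R) (f g : config R -> R).

(* [inl v] is the bit B^v and [inr (v, n)] the coin of step n+1 of X^v. *)
Local Notation bit := (int + int * nat)%type.

Definition flip (k : bit) w : config R :=
  match k with
  | inl v => Config (fun y => (y == v) (+) cars w y) (coins w) (prios w)
  | inr vn => Config (cars w)
      (fun y m => ((y, m) == vn) (+) coins w y m) (prios w)
  end.

Lemma flipK k : involutive (flip k).
Proof.
case: k => [v|vn] [c h u] /=; congr Config.
  by apply/funext => y; rewrite addKb.
by apply/funext => y; apply/funext => m; rewrite addKb.
Qed.

Lemma flipC k l w : flip k (flip l w) = flip l (flip k w).
Proof.
case: k l w => [v|vn] [v'|vn'] [c h u] //=; congr Config.
  by apply/funext => y; rewrite addbCA.
by apply/funext => y; apply/funext => m; rewrite addbCA.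
Qed.

Lemma prios_flip k w : prios (flip k w) = prios w.
Proof. by case: k. Qed.

(* [avg K f] is the conditional expectation of [f] when the bits in [K] are
   resampled and all the other randomness is frozen; being a finite average it
   makes sense for nonmeasurable [f]. *)
Definition avg1 k f w : R := (f w + f (flip k w)) / 2.

Definition avg (K : seq bit) f : config R -> R := foldr avg1 f K.

Lemma avg1C k l f : avg1 k (avg1 l f) = avg1 l (avg1 k f).
Proof.
apply/funext => w; rewrite /avg1 (flipC l k); ring.
Qed.

Lemma avg1_idem k f : avg1 k (avg1 k f) = avg1 k f.
Proof. by apply/funext => w; rewrite /avg1 flipK; field. Qed.

Lemma avg_avg1 K k f : avg K (avg1 k f) = avg1 k (avg K f).
Proof. by elim: K => [//|l K IHK] /=; rewrite IHK avg1C. Qed.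

Lemma avg_cat K L f : avg (K ++ L) f = avg K (avg L f).
Proof. exact: foldr_cat. Qed.

Lemma avg_absorb1 K k f : k \in K -> avg K (avg1 k f) = avg K f.
Proof.
elim: K => [//|l K IHK] /=; rewrite inE => /orP[/eqP <-|kK].
  by rewrite avg_avg1 avg1_idem.
by rewrite IHK.
Qed.

(** Tower property, from the commutation and idempotence of one-bit averages. *)
Lemma avg_absorb K L f : {subset L <= K} -> avg K (avg L f) = avg K f.
Proof.
elim: L => [//|l L IHL] sub /=; rewrite avg_absorb1; last first.
  by apply: sub; rewrite inE eqxx.
by apply: IHL => k kL; apply: sub; rewrite inE kL orbT.
Qed.

(** [Q] is a class of configurations that resampling cannot leave, typically those that are tie-free
    or share the past of a given one. *)
Lemma avg_le_on (Q : config R -> Prop) K f g :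
    (forall k w, k \in K -> Q w -> Q (flip k w)) ->
    (forall w, Q w -> f w <= g w) ->
  forall w, Q w -> avg K f w <= avg K g w.
Proof.
move=> + fg; elim: K => [//|k K IHK] QK w Qw /=.
have QK' l w' : l \in K -> Q w' -> Q (flip l w').
  by move=> lK; apply: QK; rewrite inE lK orbT.
rewrite /avg1 ler_pM2r // lerD // IHK //.
by apply: QK => //; rewrite inE eqxx.
Qed.

Lemma avg_le K f g : (forall w, f w <= g w) -> forall w, avg K f w <= avg K g w.
Proof. by move=> fg w; apply: (@avg_le_on (fun=> True)). Qed.

Lemma avg_inv K f :
  (forall k w, k \in K -> f (flip k w) = f w) -> avg K f = f.
Proof.
elim: K => [//|k K IHK] h /=; rewrite IHK; last first.
  by move=> l w lK; rewrite h // inE lK orbT.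
by apply/funext => w; rewrite /avg1 (h k w) ?mem_head //; field.
Qed.

Lemma avg_cst K c : avg K (fun=> c) = fun=> c.
Proof. exact: avg_inv. Qed.

Lemma avgD K f g w : avg K (fun w => f w + g w) w = avg K f w + avg K g w.
Proof.
by elim: K w => [//|k K IHK] w /=; rewrite /avg1 !IHK; ring.
Qed.

Lemma avg_sum K (I : Type) (r : seq I) (P : pred I) (F : I -> config R -> R) w :
  avg K (fun w => \sum_(i <- r | P i) F i w) w =
  \sum_(i <- r | P i) avg K (F i) w.
Proof.
elim: K w => [//|k K IHK] w /=.
rewrite /avg1 !IHK -big_split /= big_distrl /=; exact: eq_bigr.
Qed.

Definition pos w (v : int) (n : nat) : int :=
  v + \sum_(i < n) (if coins w v i then 1 else -1).

Lemma posS w v n : pos w v n.+1 = pos w v n + (if coins w v n then 1 else -1).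
Proof. by rewrite /pos big_ord_recr /= addrA. Qed.

Lemma pos0 w v : pos w v 0 = v.
Proof. by rewrite /pos big_ord0 addr0. Qed.

Lemma pos_dist w v n : `|pos w v n - v| <= n%:Z.
Proof.
elim: n => [|n IHn]; first by rewrite pos0 subrr.
by rewrite posS; move: IHn; case: ifP; lia.
Qed.

Lemma pos_flip v s w y m : (y != v) || (m <= s)%N ->
  pos (flip (inr (v, s)) w) y m = pos w y m.
Proof.
move=> h; rewrite /pos; congr (_ + _); apply: eq_bigr => i _ /=.
rewrite xpair_eqE; case/orP: h => [/negPf -> //|ms].
by rewrite (ltn_eqF (leq_trans (ltn_ord i) ms)) andbF.
Qed.

Lemma avg_step v s w (G : int -> R) :
  avg1 (inr (v, s)) (fun w => G (pos w v s.+1)) w =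
  (G (pos w v s + 1) + G (pos w v s - 1)) / 2.
Proof.
rewrite /avg1 !posS pos_flip ?leqnn ?orbT //= eqxx.
by case: (coins w v s) => //=; rewrite addrC.
Qed.

Definition tiefree w :=
  forall s (v v' : int), v != v' -> prios w v s != prios w v' s.

Lemma tiefree_flip k w : tiefree w -> tiefree (flip k w).
Proof. by rewrite /tiefree prios_flip. Qed.

Definition state_of w := state (cars w) (pos w) (prios w).
Definition driving w n v := `[< (state_of w n).1 v >].
Definition free w n y := `[< (state_of w n).2 y >].

Lemma state_of_flip v s w n : (n <= s)%N -> state_of (flip (inr (v, s)) w) n = state_of w n.
Proof.
move=> ns; rewrite /state_of prios_flip; apply: eq_state => y m mn.
by rewrite pos_flip // (leq_trans mn ns) orbT.
Qed.

Lemma driving_flip v s w n : (n <= s)%N ->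
  driving (flip (inr (v, s)) w) n =1 driving w n.
Proof. by move=> ns y; rewrite /driving state_of_flip. Qed.

Lemma drivingW m n w v : (m <= n)%N -> driving w n v -> driving w m v.
Proof. by move=> mn /asboolP h; apply/asboolP; apply: driving_le h. Qed.

End Averaging.

(** * Upper bound on the driving time *)

Section UpperBound.
Variable R : realType.
Implicit Types (w : config R) (y : int -> option int).

(** The potential of a car at [x]: the truncated mean hitting time of its assigned space, or the
    whole horizon [n] if it has none. *)
Definition cost (n : nat) (x : int) (o : option int) : R :=
  if o is Some z then hit R n (absz (x - z)%R) else n%:R.

Lemma cost_ge0 n x o : 0 <= cost n x o.
Proof. by case: o => [z|] /=; rewrite ?hit_ge0 ?ler0n. Qed.

Lemma cost_triangle n x x' o : cost n x o <= cost n x (Some x') + cost n x' o.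
Proof.
case: o => [z|] /=; last by rewrite lerDr hit_ge0.
by apply: le_trans (hit_subadd _ _ _ _); apply: le_hit; lia.
Qed.

(** A unit of driving time is paid by a unit drop of the mean potential. This fails on the assigned
    space itself, where the potential is already 0. *)
Lemma cost_step n x o : o != Some x ->
  (cost n (x + 1) o + cost n (x - 1) o) / 2 = cost n.+1 x o - 1.
Proof.
case: o => [z|] xz; last by rewrite /cost -[n.+1%:R]natr1; field.
have {}xz : x != z by apply: contra xz => /eqP ->.
rewrite /cost; case E : (absz (x - z)%R) => [|d]; first by lia.
rewrite hitS [RHS]addrC addKr.
have [lt_xz|le_zx] := ltP x z.
  have -> : absz (x + 1 - z)%R = d by lia.
  by have -> : absz (x - 1 - z)%R = d.+2 by lia.
have -> : absz (x + 1 - z)%R = d.+2 by lia.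
have -> : absz (x - 1 - z)%R = d by lia.
by rewrite (addrC (hit _ _ _)).
Qed.

(** [J] is a finite window of cars. By the hypothesis [reachJ] only they can visit a site that is
    not [far] up to time [t], so no outside car can take an assigned space. *)
Variables (J : seq int) (far : int -> Prop) (t : nat).

Definition step_coins s : seq (int + int * nat) := [seq inr (v, s) | v <- J].

Fixpoint time_coins s n : seq (int + int * nat) :=
  if n is n'.+1 then step_coins s ++ time_coins s.+1 n' else [::].

Lemma step_coinsP k s : k \in step_coins s -> exists2 v, v \in J & k = inr (v, s).
Proof. by case/mapP => v vJ ->; exists v. Qed.

(* [y] assigns to some of the driving cars of [J] distinct free spaces that no
   car outside [J] can reach. *)
Definition assignment w s y := forall v, v \in J -> driving w s v ->
  (forall z, y v = Some z -> free w s z /\ ~ far z) /\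
  (forall v', v' \in J -> driving w s v' -> y v -> y v = y v' -> v = v').

Hypothesis uJ : uniq J.
Hypothesis reachJ : forall w v s,
  (s <= t)%N -> ~ far (pos w v s) -> v \in J.

(** [reassign] is applied at the positions of time [s + 1], with [Ps] the cars of [J] parking then.
    The spaces kept stay free: a car taking one would be in [J], hence in [Ps]. *)
Lemma assignment_step n w s y : tiefree w -> (s < t)%N -> assignment w s y ->
  exists2 y', assignment w s.+1 y' &
    \sum_(v <- J | driving w s.+1 v) cost n (pos w v s.+1) (y' v) <=
    \sum_(v <- J | driving w s v) cost n (pos w v s.+1) (y v).
Proof.
move=> tie lt_st ay; pose x v := pos w v s.+1.
pose A := [seq v <- J | driving w s v].
pose N v := `[< parkers (pos w) (prios w) (state_of w s).1 (state_of w s).2 s.+1 v >].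
pose Ps := [seq v <- A | N v]; pose L := [seq v <- A | predC N v].
have pPL : perm_eq (Ps ++ L) A by rewrite /Ps /L perm_filterC.
have AP v : (v \in A) = (driving w s v) && (v \in J) by rewrite mem_filter.
have LP v : (v \in L) = (driving w s.+1 v) && (v \in J).
  rewrite mem_filter AP andbA; congr (_ && _).
  apply/andP/asboolP.
    by move=> [/asboolP nN /asboolP Dv]; apply/drivingS.
  by move=> /drivingS[Dv nN]; split; apply/asboolP.
have [] := @reassign R (cost n) x (cost_ge0 n) _ Ps L y.
- by move=> i j o; exact: cost_triangle.
- by rewrite (perm_uniq pPL) filter_uniq.
- move=> v v'; rewrite !(perm_mem pPL) !AP => /andP[Dv vJ] /andP[Dv' v'J] Yv e.
  by have [_ h] := ay v vJ Dv; exact: h.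
move=> y' [y'inj y'old y'c]; exists y'.
  move=> v vJ Dv; have vL : v \in L by rewrite LP vJ Dv.
  split; last first.
    by move=> v' v'J Dv' ; apply: y'inj => //; rewrite LP v'J Dv'.
  move=> z y'z; have [zPs [v' + yz]] := y'old v vL z y'z.
  rewrite (perm_mem pPL) AP => /andP[Dv' v'J].
  have [/(_ z yz)[/asboolP Fz fz] _] := ay v' v'J Dv'.
  split=> //; apply/asboolP/freeS; split=> // v1 Nv1 xz.
  move/negP: zPs; apply; apply/mapP; exists v1 => //.
  rewrite mem_filter AP; apply/and3P; split; first exact/asboolP.
    by apply/asboolP; case: Nv1.
  by apply: (reachJ (s := s.+1) (w := w)) => //; rewrite xz.
apply: le_trans (_ : \sum_(v <- Ps ++ L) cost n (x v) (y v) <= _); last first.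
  by rewrite (perm_big _ pPL) big_filter.
apply: le_trans y'c; rewrite -[leLHS]big_filter.
suff pe : perm_eq [seq v <- J | driving w s.+1 v] L by rewrite (perm_big _ pe).
apply: uniq_perm; rewrite ?filter_uniq // => v; by rewrite LP mem_filter.
Qed.

(** Induction on the number of steps, with the total cost of the driving cars as potential: moving
    lowers each term by 1 on average, and reassigning after the parkings does not raise the sum. *)
Lemma avg_driving_le n s w y : tiefree w -> (s + n <= t)%N -> assignment w s y ->
  avg (time_coins s n)
    (fun w' => \sum_(r < n) \sum_(v <- J) (driving w' (s + r) v)%:R) w <=
  \sum_(v <- J | driving w s v) cost n (pos w v s) (y v).
Proof.
elim: n s w y => [|n IHn] s w y tie sn ay.
  by rewrite /= big_ord0 sumr_ge0 // => v _; exact: cost_ge0.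
rewrite /= avg_cat.
(* [Q] freezes the history up to time [s], which the coins of the next step cannot alter. *)
pose Q w' := [/\ tiefree w', forall m, (m <= s)%N -> state_of w' m = state_of w m &
                 forall v, pos w' v s = pos w v s].
have Qw : Q w by [].
have QK k w' : k \in step_coins s -> Q w' -> Q (flip k w').
  move=> /step_coinsP[v vJ ->] [tw sw pw]; split; first exact: tiefree_flip.
  - by move=> m ms; rewrite state_of_flip // sw.
  - by move=> v'; rewrite pos_flip ?leqnn ?orbT // pw.
pose A := [seq v <- J | driving w s v].
have dw w' : Q w' -> driving w' s =1 driving w s.
  by move=> [_ sw _] v; rewrite /driving sw.
(* Time [s] costs 1 per driving car; the later times cost, by induction, at most the potential at
   the new positions. *)
pose g w' := \sum_(v <- A) (1 + cost n (pos w' v s.+1) (y v)).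
apply: le_trans (_ : avg (step_coins s) g w <= _).
  apply: (avg_le_on QK) Qw => w' Qw'; have [tw' sw' pw'] := Qw'.
  rewrite (_ : (fun w => _) = (fun w => \sum_(v <- J) (driving w s v)%:R +
    \sum_(r < n) \sum_(v <- J) (driving w (s.+1 + r) v)%:R)); last first.
    apply/funext => w1; rewrite big_ord_recl addn0; congr (_ + _).
    by apply: eq_bigr => r _; rewrite /= /bump addSnnS.
  rewrite avgD /g big_split /=; apply: lerD.
    rewrite avg_inv.
      rewrite big_filter [leRHS]big_mkcond /=; apply: ler_sum => v _.
      by rewrite (dw _ Qw'); case: ifP.
    move=> k w1 kK; apply: eq_bigr => v _.
    suff [v0 [m [sm ->]]] : exists v0 m, (s < m)%N /\ k = inr (v0, m).
      by rewrite driving_flip // ltnW.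
    move: kK; elim: (n) (s) => [//|n0 IH] s0 /=.
    rewrite mem_cat => /orP[/step_coinsP[v0 _ ->]|/IH[v0 [m [sm ->]]]].
      by exists v0, s0.+1.
    by exists v0, m; split=> //; exact: ltnW.
  have ay' : assignment w' s y.
    move=> v vJ; rewrite /assignment !(dw _ Qw') => Dv.
    have [h1 h2] := ay v vJ Dv; split.
      by move=> z /h1[Fz fz]; rewrite /free sw'.
    by move=> v' v'J; rewrite (dw _ Qw'); exact: h2.
  have lt_st : (s < t)%N by apply: leq_trans sn; rewrite addnS ltnS leq_addr.
  have [y' ay1 h] := assignment_step n tw' lt_st ay'.
  apply: le_trans (IHn s.+1 w' y' tw' _ ay1) _; first by rewrite addSnnS.
  apply: le_trans h _; rewrite big_filter.
  by rewrite (eq_bigl _ _ (dw _ Qw')).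
rewrite /g avg_sum -[leRHS]big_filter.
rewrite big_seq [leRHS]big_seq; apply: ler_sum => v.
rewrite mem_filter => /andP[Dv vJ].
have kK : inr (v, s) \in step_coins s by apply: map_f.
rewrite avgD avg_cst -(avg_absorb1 _ kK).
rewrite (_ : avg1 _ _ = fun w' => (cost n (pos w' v s + 1) (y v) +
  cost n (pos w' v s - 1) (y v)) / 2); last first.
  by apply/funext => w'; rewrite (avg_step v s w' (fun p => cost n p (y v))).
rewrite avg_inv; last first.
  by move=> k w' /step_coinsP[v0 _ ->]; rewrite pos_flip ?leqnn ?orbT.
rewrite cost_step ?subrKC ?addrC ?subrK //.
apply/eqP => yv; have [/(_ _ yv)[/asboolP Fv _] _] := ay v vJ Dv.
move/asboolP: Dv => Dv.
exact: (driving_not_free (pos_dist w) tie Dv Fv).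
Qed.

End UpperBound.

(** * Bracket matching of cars with spaces *)

Section Matching.
Implicit Type b : int -> bool.

(* Reads the sites from [z] on as a bracket sequence (cars open, spaces close)
   and returns the space closing the bracket that has [h] pending ones inside. *)
Fixpoint mate b (n h : nat) (z : int) : option int :=
  if n is n'.+1 then
    if b z then mate b n' h.+1 (z + 1)
    else if h is h'.+1 then mate b n' h' (z + 1) else Some z
  else None.

Lemma mate_bounds b n h z z' : mate b n h z = Some z' ->
  [/\ z <= z', z' < z + n%:Z & ~~ b z'].
Proof.
elim: n h z => [//|n IHn] h z /=.
case: ifPn => [_ /IHn[]|bz]; first by split => //; lia.
case: h => [|h]; first by case=> <-; split => //; lia.
by move=> /IHn[]; split => //; lia.
Qed.

(** Both scans read the same sites, so the gap between their pending counts persists and the smaller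
    count runs out first. *)
Lemma mate_lt b n n' h h' z z1 z2 : (h < h')%N ->
  mate b n h z = Some z1 -> mate b n' h' z = Some z2 -> z1 < z2.
Proof.
elim: n n' h h' z => [//|n IHn] [//|n'] h h' z hh' /=.
case: ifP => _; first exact: IHn.
case: h' hh' => [//|h'] hh'; case: h hh' => [|h] hh'; last exact: IHn.
by case=> <- /mate_bounds[]; lia.
Qed.

Lemma mate_pass b n h z z' w : mate b n h z = Some z' ->
  z <= w -> w < z' -> b w -> exists n' h', mate b n' h'.+1 (w + 1) = Some z'.
Proof.
elim: n h z => [//|n IHn] h z /= + zw wz' bw.
have [->|zw'] := eqVneq z w; first by rewrite bw; exists n, h.
have {}zw : z + 1 <= w by lia.
case: ifP => _; first by move=> /IHn; exact.
by case: h => [|h]; [case=> ?; lia|move=> /IHn; exact].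
Qed.

(** For [v < w] the scan from [v] passes the car [w] and then has at least one more bracket pending
    than the scan from [w], so it closes strictly later. *)
Lemma mate_inj b n v w z : b v -> b w ->
  mate b n 0 (v + 1) = Some z -> mate b n 0 (w + 1) = Some z -> v = w.
Proof.
wlog vw : v w / v < w.
  move=> wlog bv bw mv mw; have [vw|wv|//] := ltgtP v w; first exact: wlog.
  by apply/esym; exact: wlog.
move=> bv bw mv mw; have [zw _ _] := mate_bounds mw.
have [||n' [h' m']] := mate_pass mv _ _ bw; [lia..|].
by have := mate_lt (ltn0Sn h') mw m'; rewrite ltxx.
Qed.

End Matching.

(** * Mean cost of the bracket matching *)

Section ExpectedCost.
Variable R : realType.
Implicit Types (w : config R).

Fixpoint site_bits (z : int) (n : nat) : seq (int + int * nat) :=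
  if n is n'.+1 then inl z :: site_bits (z + 1) n' else [::].

Lemma site_bitsP (z : int) n (k : int + int * nat) :
  reflect (exists2 y : int, z <= y < z + n%:Z & k = inl y) (k \in site_bits z n).
Proof.
elim: n z k => [|n IHn] z k /=; first by apply: ReflectF => -[y]; lia.
rewrite inE; apply: (iffP orP) => [[/eqP ->|/IHn[y yz ->]]|[y yz ->]].
- by exists z => //; lia.
- by exists y => //; lia.
- by have [->|yz'] := eqVneq y z; [left|right; apply/IHn; exists y => //; lia].
Qed.

(** As fair bits are read, the pending count [h] performs a simple random walk that stops on its way
    from 0 to -1, whence [hit R n h.+1] for the mean number of sites read. By [hit_le_sqrt] each
    unit of distance costs at most [2 l]. *)
Lemma avg_mate_le t l n h z v w : (t <= l ^ 2)%N ->
  v <= z -> v + l%:Z <= z + n%:Z ->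
  avg (site_bits z n) (fun w => cost R t v (mate (cars w) n h z)) w <=
  2 * l%:R * ((absz (z - v)%R)%:R + hit R n h.+1).
Proof.
move=> tl; elim: n h z w => [|n IHn] h z w vz lz.
  (* No mate was found, but the scan has covered at least [l] sites, so the full price [t <= l^2] is
     below [2 l] times the distance. *)
  rewrite /= addr0 -natrM -natrM ler_nat; apply: leq_trans tl _.
  by rewrite -mulnn leq_mul //; lia.
pose c := 2 * l%:R : R.
have c0 : 0 <= c by rewrite mulr_ge0.
pose F w := cost R t v (mate (cars w) n.+1 h z).
(* The bits beyond [z] are averaged first; averaging over the bit at [z] then reproduces the
   recursion of [hit]. *)
have key w1 : avg (site_bits (z + 1) n) F w1 <=
    if cars w1 z then c * ((absz (z - v)%R)%:R + 1 + hit R n h.+2)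
    else c * ((absz (z - v)%R)%:R + 1 + hit R n h).
  have Qcl k w' : k \in site_bits (z + 1) n -> cars w' z = cars w1 z ->
      cars (flip k w') z = cars w1 z.
    by move=> /site_bitsP[y yz ->] /=; have -> : (z == y) = false by lia.
  have zv1 : (absz (z + 1 - v)%R)%:R = (absz (z - v)%R)%:R + 1 :> R.
    by rewrite natr1; congr _%:R; lia.
  have IH h' : avg (site_bits (z + 1) n)
      (fun w => cost R t v (mate (cars w) n h' (z + 1))) w1 <=
      c * ((absz (z - v)%R)%:R + 1 + hit R n h'.+1).
    by rewrite -zv1; apply: IHn; lia.
  case: ifP => bz.
    apply: le_trans (IH h.+1); apply: (avg_le_on Qcl) => // w' e.
    by rewrite /F /= e bz.
  case: h @F IH => [|h] F IH.
    apply: le_trans (_ : avg (site_bits (z + 1) n)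
      (fun=> c * (absz (z - v)%R)%:R) w1 <= _).
      apply: (avg_le_on Qcl) => // w' e; rewrite /F /= e bz /=.
      have -> : absz (v - z)%R = absz (z - v)%R by lia.
      by rewrite /c mulrAC; exact: hit_le_sqrt.
    rewrite avg_cst hit0 ler_wpM2l //; lra.
  apply: le_trans (IH h); apply: (avg_le_on Qcl) => // w' e.
  by rewrite /F /= e bz.
rewrite [avg _ _]/= -/F /avg1 hitS.
have := key w; have := key (flip (inl z) w); rewrite /= eqxx -/c.
set A := (absz _)%:R; set x := hit R n h; set y := hit R n h.+2.
have -> : c * (A + (1 + (x + y) / 2)) = (c * (A + 1 + x) + c * (A + 1 + y)) / 2.
  by field.
by case: (cars w z) => /=; lra.
Qed.

Lemma ler_sum_size (I : eqType) (r : seq I) (F : I -> R) c :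
  {in r, forall i, F i <= c} -> \sum_(i <- r) F i <= (size r)%:R * c.
Proof.
move=> Fc; rewrite big_seq; apply: le_trans (ler_sum _ Fc) _.
by rewrite -big_seq big_const_seq count_predT iter_addr_0 mulr_natl.
Qed.

Lemma sum_window (F : int -> R) a N M :
  \sum_(v <- [seq i%:Z - a%:Z | i <- iota 0 (a + (N + M))]) F v =
  \sum_(v <- [seq i%:Z - a%:Z | i <- iota 0 a]) F v +
  (\sum_(i < N) F (i : nat)%:Z + \sum_(v <- [seq (N + i)%N%:Z | i <- iota 0 M]) F v).
Proof.
rewrite iotaD map_cat big_cat add0n /=; congr (_ + _).
rewrite iotaD map_cat big_cat /=; congr (_ + _).
  rewrite -[a in iota a N]addn0 iotaDl -map_comp big_map.
  rewrite -(big_mkord xpredT (fun i => F i%:Z)) /index_iota subn0.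
  by apply: eq_bigr => i _ /=; congr F; lia.
rewrite -[(a + N)%N]addn0 iotaDl -!map_comp !big_map.
by apply: eq_bigr => i _ /=; congr F; lia.
Qed.

(** Cars starting in [[0, N)] get their mate if it is among the next [l] sites. The other
    [l + 2t + 1] cars of the window get no space and pay [t] each, a boundary term that disappears
    per car as [N] grows. *)
Theorem avg_driving_time_le t l N : (t <= l ^ 2)%N ->
  exists K, forall w, tiefree w ->
  avg K (fun w => \sum_(r < t) \sum_(i < N) (driving w r (i : nat)%:Z)%:R) w <=
  N%:R * (2 * l%:R * (1 + hit R l 1)) + (l + t.*2).+1%:R * t%:R.
Proof.
move=> tl.
pose M := (l + t).+1.
pose J : seq int := [seq (i%:Z - t%:Z)%R | i <- iota 0 (t + (N + M))].
have JP v : (v \in J) = (- t%:Z <= v < (N + M)%N%:Z).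
  apply/mapP/idP => [[i]|vb]; first by rewrite mem_iota => ib ->; lia.
  by exists (absz (v + t%:Z)%R); [rewrite mem_iota|]; lia.
have uJ : uniq J by rewrite map_inj_uniq ?iota_uniq // => i j; lia.
pose far (z : int) := ~ (0 <= z <= (N + l)%N%:Z).
have reachJ w (v : int) s : (s <= t)%N -> ~ far (pos w v s) -> v \in J.
  move=> st /contrapT; have := pos_dist w v s; rewrite JP /M; lia.
pose y w (v : int) :=
  if 0 <= v < N%:Z then mate (cars w) l 0 (v + 1) else None.
have ay w : assignment J far w 0 (y w).
  move=> v vJ /asboolP dv; split.
    rewrite /y; case: ifP => // vN z /mate_bounds[h1 h2 h3].
    by split; [exact/asboolP|rewrite /far; lia].
  move=> v' v'J /asboolP dv'; rewrite /y.
  case: ifP => // _; case: ifP => // _; last by move=> + e; rewrite e.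
  by case E: (mate _ _ _ (v + 1)) => [z|//] _ E'; apply: mate_inj (esym E').
pose B := site_bits 0 (N + l).
exists (B ++ time_coins J 0 t) => w tie; rewrite avg_cat.
apply: le_trans (_ : avg B (fun w => \sum_(v <- J) cost R t v (y w v)) w <= _).
  apply: (@avg_le_on _ (@tiefree R)) tie => [k w' _|w' tie']; first exact: tiefree_flip.
  have h := @avg_driving_le R J far t uJ reachJ t 0 w' _ tie' (leqnn t) (ay w').
  apply: le_trans (_ : avg (time_coins J 0 t) (fun w' =>
      \sum_(r < t) \sum_(v <- J) (driving w' (0 + r) v)%:R) w' <= _).
    apply: avg_le => w1; apply: ler_sum => r _; rewrite add0n.
    rewrite sum_window addrCA lerDl.
    by rewrite addr_ge0 // sumr_ge0 // => v _; rewrite ler0n.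
  apply: le_trans h _.
  rewrite big_mkcond; apply: ler_sum => v _; rewrite pos0.
  by case: ifP => // _; exact: cost_ge0.
rewrite avg_sum.
pose c := 2 * l%:R * (1 + hit R l 1).
have yc v : avg B (fun w => cost R t v (y w v)) w <= if 0 <= v < N%:Z then c else t%:R.
  case: ifP => vN; last first.
    by rewrite (_ : (fun w => _) = fun=> t%:R) ?avg_cst //; apply/funext => w'; rewrite /y vN.
  rewrite (_ : (fun w => _) = fun w => cost R t v (mate (cars w) l 0 (v + 1))); last first.
    by apply/funext => w'; rewrite /y vN.
  have sub : {subset site_bits (v + 1) l <= B}.
    by move=> k /site_bitsP[z zl ->]; apply/site_bitsP; exists z => //; lia.
  rewrite -(avg_absorb _ sub).
  apply: le_trans (_ : avg B (fun=> c) w <= _); last by rewrite avg_cst.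
  apply: avg_le => w'; have e1 : absz (v + 1 - v)%R = 1%N by lia.
  have := @avg_mate_le t l l 0 (v + 1) v w' tl; rewrite e1; apply; lia.
apply: le_trans (ler_sum _ (fun v _ => yc v)) _.
rewrite sum_window.
have -> : (l + t.*2).+1%:R = t%:R + M%:R :> R by rewrite -natrD; congr _%:R; lia.
rewrite (mulrDl t%:R) addrCA; apply: lerD; last apply: lerD.
- rewrite (_ : N%:R * _ = \sum_(i < N) c); last by rewrite sumr_const card_ord mulr_natl.
  apply: ler_sum => i _.
  by rewrite ifT //; have := ltn_ord i; lia.
- apply: le_trans (ler_sum_size (c := t%:R) _) _; last by rewrite size_map size_iota.
  by move=> _ /mapP[i + ->]; rewrite mem_iota => it; rewrite ifF //; lia.
- apply: le_trans (ler_sum_size (c := t%:R) _) _; last by rewrite size_map size_iota.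
  by move=> _ /mapP[i + ->]; rewrite mem_iota => it; rewrite ifF //; lia.
Qed.

End ExpectedCost.

(** * Lower bound on the number of driving cars *)

Section Displacement.
Variable R : realType.
Implicit Types (w : config R).

(** Driving is tested before the step and the distance after it, so that the site where the car
    parks counts. *)
Definition reaches w (t : nat) (v : int) (j : nat) :=
  [exists s : 'I_t, driving w s v && (j%:Z <= `|pos w v s.+1 - v|)].

(** The running maximum is carried in the accumulator [r] because it is a state variable of the
    supermartingale below. *)
Fixpoint maxdist w (v : int) (n s : nat) (r : R) : R :=
  if n is n'.+1 then
    if driving w s v then
      maxdist w v n' s.+1 (Num.max r `|pos w v s.+1 - v|%:~R)
    else r
  else r.

Lemma le_maxdist w v n s r r' : r <= r' -> maxdist w v n s r <= maxdist w v n s r'.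
Proof.
elim: n s r r' => [//|n IHn] s r r' rr' /=; case: ifP => // _.
by apply: IHn; rewrite ge_max !le_max lexx rr' !orbT.
Qed.

Lemma maxdist_ge w v n s r : r <= maxdist w v n s r.
Proof.
elim: n s r => [//|n IHn] s r /=; case: ifP => // _.
by apply: le_trans (IHn _ _); rewrite le_max lexx.
Qed.

Lemma maxdist_reaches w v n s r i : (i < n)%N -> driving w (s + i) v ->
  `|pos w v (s + i).+1 - v|%:~R <= maxdist w v n s r.
Proof.
elim: n s r i => [//|n IHn] s r i i_n di /=.
have -> : driving w s v by apply: drivingW di; exact: leq_addr.
case: i i_n di => [|i] i_n di; last by rewrite -addSnnS; apply: IHn; rewrite ?addSnnS.
by rewrite addn0; apply: le_trans (maxdist_ge _ _ _ _ _); rewrite le_max lexx orbT.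
Qed.

Lemma sum_threshold (p : nat -> bool) (m : R) n : 0 <= m ->
  (forall j, p j -> j.+1%:R <= m) -> \sum_(j < n) (p j)%:R <= m.
Proof.
move=> m0 pm; elim: n => [|n IHn]; first by rewrite big_ord0.
rewrite big_ord_recr /=; case: (boolP (p n)) => [/pm nm|_]; last by rewrite addr0.
apply: le_trans nm; rewrite -natr1 lerD //.
apply: le_trans (ler_sum _ (G := fun=> 1) _) _; last by rewrite sumr_const card_ord.
by move=> j _; case: (p j).
Qed.

(** Tail-sum formula: the levels reached number at most the maximal displacement. *)
Lemma sum_reaches_le w t v n :
  \sum_(j < n) (reaches w t v j.+1)%:R <= maxdist w v t 0 1.
Proof.
apply: (@sum_threshold (fun j => reaches w t v j.+1)).
  by apply: le_trans (maxdist_ge _ _ _ _ _).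
move=> j /existsP[s /andP[ds js]].
apply: le_trans (maxdist_reaches (s := 0) 1 (ltn_ord s) ds).
by rewrite add0n -[j.+1%:R]/(j.+1%:Z%:~R) ler_int.
Qed.

(* Supermartingale: r + x^2 / r, where r >= sqrt (s + 1) bounds the distances
   reached so far and x is the current displacement. *)
Lemma avg_maxdist_le v n s r w : Num.sqrt s.+1%:R <= r ->
  avg (time_coins [:: v] s n) (fun w => maxdist w v n s r) w <=
  r + (pos w v s - v)%:~R ^+ 2 / r +
  avg (time_coins [:: v] s n)
    (fun w => \sum_(i < n) 2 / Num.sqrt (s + i).+1%:R * (driving w (s + i) v)%:R) w.
Proof.
elim: n s r w => [|n IHn] s r w sr.
  rewrite /= big_ord0 addr0 lerDl divr_ge0 ?sqr_ge0 //.
  by apply: le_trans sr; rewrite sqrtr_ge0.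
set d := Num.sqrt s.+1%:R in sr *.
have d0 : 0 < d by rewrite sqrtr_gt0 ltr0n.
have d2 : d ^+ 2 = s.+1%:R by rewrite sqr_sqrtr.
have r0 : 0 < r by exact: lt_le_trans sr.
pose K := time_coins [:: v] s.+1 n; pose k : int + int * nat := inr (v, s).
have -> : time_coins [:: v] s n.+1 = k :: K by [].
have Kk k' : k' \in K -> exists2 m, (s < m)%N & k' = inr (v, m).
  rewrite /K; elim: (n) (s) => [//|n0 IH] s0 /=; rewrite inE.
  move=> /orP[/eqP ->|/IH[m sm ->]]; first by exists s0.+1.
  by exists m => //; exact: ltnW.
have Kd w' : w' = w \/ w' = flip k w -> driving w' s v = driving w s v.
  by case=> [->|->] //; rewrite /k driving_flip.
pose g w' : R := \sum_(i < n) 2 / Num.sqrt (s.+1 + i).+1%:R * (driving w' (s.+1 + i) v)%:R.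
have -> : (fun w => \sum_(i < n.+1) 2 / Num.sqrt (s + i).+1%:R *
    (driving w (s + i) v)%:R) = (fun w => 2 / d * (driving w s v)%:R + g w).
  apply/funext => w'; rewrite big_ord_recl addn0; congr (_ + _).
  by apply: eq_bigr => i _; rewrite /= /bump addSnnS.
have Kinv w' : avg K (fun w => 2 / d * (driving w s v)%:R) w' =
    2 / d * (driving w' s v)%:R.
  rewrite avg_inv // => k' w1 k'K; have [m sm ->] := Kk k' k'K.
  by rewrite driving_flip // ltnW.
rewrite /= /avg1 !avgD !Kinv !Kd; try by [left|right].
case: (boolP (driving w s v)) => ds; last first.
  have h w' : w' = w \/ w' = flip k w ->
      avg K (fun w => if driving w s v then
        maxdist w v n s.+1 (Num.max r `|pos w v s.+1 - v|%:~R) else r) w' <= r.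
    move=> w'w.
    apply: le_trans (_ : avg K (fun=> r) w' <= _); last by rewrite avg_cst.
    apply: (@avg_le_on _ (fun w1 => driving w1 s v = driving w s v)).
    - move=> k' w1 k'K; have [m sm ->] := Kk k' k'K.
      by rewrite driving_flip // ltnW.
    - by move=> w1 ->; rewrite (negPf ds).
    - exact: Kd.
  have h1 := h w (or_introl erefl); have h2 := h _ (or_intror erefl).
  have g0 w' : 0 <= avg K g w'.
    rewrite -[leLHS]/((fun=> 0) w') -(avg_cst K); apply: avg_le => w1.
    by apply: sumr_ge0 => i _; rewrite mulr_ge0 // divr_ge0 // sqrtr_ge0.
  have := g0 w; have := g0 (flip k w).
  have : 0 <= (pos w v s - v)%:~R ^+ 2 / r by rewrite divr_ge0 ?sqr_ge0 // ltW.
  rewrite mulr0; lra.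
(* Adding [1/d] keeps the threshold above the square root, since
   [(d + 1/d)^2 >= d^2 + 2 >= s + 2]. *)
pose q := r + d^-1.
have q0 : 0 < q by rewrite addr_gt0 ?invr_gt0.
pose x w' : R := (pos w' v s.+1 - v)%:~R.
have h w' : w' = w \/ w' = flip k w ->
    avg K (fun w => if driving w s v then
      maxdist w v n s.+1 (Num.max r `|pos w v s.+1 - v|%:~R) else r) w' <=
    q + x w' ^+ 2 / q + avg K g w'.
  move=> w'w; pose r1 := Num.max q `|x w'|.
  have r10 : 0 < r1 by rewrite lt_max q0.
  apply: le_trans (_ : avg K (fun w => maxdist w v n s.+1 r1) w' <= _).
    apply: (@avg_le_on _ (fun w1 => driving w1 s v = driving w s v /\
      pos w1 v s.+1 = pos w' v s.+1)).
    - move=> k' w1 k'K; have [m sm ->] := Kk k' k'K.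
      by rewrite (driving_flip _ _ (ltnW sm)) pos_flip // sm orbT.
    - move=> w1 [-> ->]; rewrite ds; apply: le_maxdist.
      rewrite ge_max !le_max -intr_norm lexx orbT andbT.
      by rewrite /q lerDl invr_ge0 ltW.
    - by rewrite Kd.
  have sq : Num.sqrt s.+2%:R <= r1.
    rewrite le_max; apply/orP; left.
    rewrite -(ger0_norm (ltW q0)) -sqrtr_sqr ler_wsqrtr //.
    apply: le_trans (_ : (d + d^-1) ^+ 2 <= _); last first.
      have dq : d + d^-1 <= q by rewrite /q lerD2r.
      by apply: lerXn2r dq; rewrite nnegrE ltW // addr_gt0 ?invr_gt0.
    rewrite -[s.+2%:R]natr1 -d2 sqrrD divff ?gt_eqF //.
    have := sqr_ge0 d^-1; lra.
  apply: le_trans (IHn s.+1 r1 w' sq) _; rewrite lerD2r -/(x w').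
  (* If [|x|] exceeds [q], then [r1 = |x|] and [r1 + x^2 / r1 = 2 |x|], which is at most
     [q + x^2 / q] by AM-GM. *)
  have [xq|qx] := leP `|x w'| q; first by rewrite /r1 max_l.
  rewrite /r1 (max_r (ltW qx)) -[x w' ^+ 2]real_normK ?num_real //.
  set y := `|x w'| in qx *; have y0 : 0 < y by exact: lt_trans qx.
  rewrite expr2 mulfK ?gt_eqF // -subr_ge0.
  have -> : q + y * y / q - (y + y) = (y - q) ^+ 2 / q by field; rewrite gt_eqF.
  by rewrite divr_ge0 ?sqr_ge0 ?ltW.
have h1 := h w (or_introl erefl); have h2 := h _ (or_intror erefl).
set X : R := (pos w v s - v)%:~R.
have xx : x w ^+ 2 + x (flip k w) ^+ 2 = 2 * (X ^+ 2 + 1).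
  rewrite /x !posS pos_flip ?leqnn ?orbT //= eqxx /X.
  case: (coins w v s) => /=; rewrite !intrD !rmorphN /= !rmorph1; ring.
(* One [1/d] comes from raising the threshold, the other from the unit variance of the step. *)
have qX : q + (X ^+ 2 + 1) / q <= r + X ^+ 2 / r + 2 / d.
  have rq : q^-1 <= r^-1 by rewrite lef_pV2 ?posrE // lerDl invr_ge0 ltW.
  have dr : r^-1 <= d^-1 by rewrite lef_pV2.
  have Xq : X ^+ 2 * q^-1 <= X ^+ 2 * r^-1 by rewrite ler_wpM2l ?sqr_ge0.
  have qE : q = r + d^-1 by [].
  rewrite mulrDl mul1r; move: rq dr Xq qE; lra.
have : (x w ^+ 2 / q + x (flip k w) ^+ 2 / q) / 2 = (X ^+ 2 + 1) / q.
  by rewrite -mulrDl xx; field; rewrite gt_eqF.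
rewrite mulr1; lra.
Qed.

Lemma avg_sum_reaches_le v t n :
  exists K, forall w,
    avg K (fun w => \sum_(j < n) (reaches w t v j.+1)%:R) w <=
    avg K (fun w => 1 + \sum_(s < t) 2 / Num.sqrt s.+1%:R * (driving w s v)%:R) w.
Proof.
exists (time_coins [:: v] 0 t) => w.
apply: le_trans (_ : avg (time_coins [:: v] 0 t) (fun w => maxdist w v t 0 1) w <= _).
  by apply: avg_le => w'; exact: sum_reaches_le.
apply: le_trans (avg_maxdist_le _ _ _ _) _; first by rewrite sqrtr1.
by rewrite pos0 subrr expr0n mul0r addr0 avgD avg_cst.
Qed.

End Displacement.

(** * Balance of cars and spaces in an interval *)

Section Balance.
Variable R : realType.
Implicit Types (w : config R).

Lemma parked_time w t v : cars w v -> ~~ driving w t v ->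
  exists2 s, (s < t)%N &
    parkers (pos w) (prios w) (state_of w s).1 (state_of w s).2 s.+1 v.
Proof.
move=> cv; elim: t => [|t IHt]; first by move=> /asboolPn[].
case: (boolP (driving w t v)) => [/asboolP Dt /asboolPn nD|/IHt[s st ps] _].
  by exists t => //; apply: contrapT => nN; apply: nD; apply/drivingS.
by exists s => //; exact: ltnW.
Qed.

Definition excess w (z : int) (n : nat) : int :=
  \sum_(i < n) (if cars w (z + (i : nat)%:Z) then 1 else -1).

(** A car of [[0, n)] that has parked by time [t] without a displacement large enough to leave took
    a space of the interval. Distinct cars took distinct spaces, since a taken space never becomes
    free again. *)
Lemma excess_le w t n :
  excess w 0 n <= (\sum_(i < n) driving w t (i : nat)%:Z +
    \sum_(i < n) (reaches w t (i : nat)%:Z i.+1 + reaches w t (i : nat)%:Z (n - i)))%N%:Z.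
Proof.
pose C := [set i : 'I_n | cars w (i : nat)%:Z]%SET.
pose D := [set i : 'I_n | driving w t (i : nat)%:Z]%SET.
(* Leaving [[0, n)] from [i] needs displacement [i + 1] to the left or [n - i] to the right. *)
pose L := [set i : 'I_n | reaches w t (i : nat)%:Z i.+1 ||
                          reaches w t (i : nat)%:Z (n - i)]%SET.
have -> : excess w 0 n = #|C|%:Z - #|~: C|%:Z.
  rewrite /excess; transitivity (\sum_(i < n) ((i \in C)%:Z - (i \in ~: C)%:Z)).
    by apply: eq_bigr => i _; rewrite !inE; case: ifP.
  have cardZ (A : {set 'I_n}) : \sum_(i < n) (i \in A)%:Z = #|A|%:Z.
    rewrite -sum1_card (big_morph Posz PoszD (erefl 0%:Z)) [RHS]big_mkcond /=.
    by apply: eq_bigr => i _; case: ifP.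
  by rewrite big_split sumrN !cardZ.
suff : (#|C :\: D :\: L| <= #|~: C|)%N.
  have hD : (#|D| <= \sum_(i < n) driving w t (i : nat)%:Z)%N.
    rewrite -sum1_card big_mkcond /=; apply: leq_sum => i _.
    by rewrite inE; case: ifP.
  have hL : (#|L| <= \sum_(i < n) (reaches w t (i : nat)%:Z i.+1 +
      reaches w t (i : nat)%:Z (n - i)))%N.
    rewrite -sum1_card big_mkcond /=; apply: leq_sum => i _.
    by rewrite inE; case: (reaches _ _ _ _); case: (reaches _ _ _ _).
  have hC : (#|C| <= #|C :\: D :\: L| + #|D| + #|L|)%N.
    apply: leq_trans (_ : #|(C :\: D :\: L) :|: D :|: L| <= _)%N.
      apply: subset_leq_card; apply/fintype.subsetP => i iC.
      by rewrite !inE; rewrite inE in iC; rewrite iC; case: (driving _ _ _);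
        case: (reaches _ _ _ _); case: (reaches _ _ _ _).
    apply: leq_trans (leq_card_setU _ _) _; rewrite leq_add2r.
    exact: leq_card_setU.
  lia.
pose B := C :\: D :\: L.
have parked (i : 'I_n) : i \in B -> exists p : 'I_n * nat,
    [/\ parkers (pos w) (prios w) (state_of w p.2).1 (state_of w p.2).2 p.2.+1 (i : nat)%:Z,
     pos w (i : nat)%:Z p.2.+1 = (p.1 : nat)%:Z & p.1 \in ~: C].
  rewrite !inE negb_or => /andP[/andP[nL1 nL2] /andP[nD Ci]].
  have [s st Ps] := parked_time Ci nD; have [Ds Fs _] := Ps.
  move: nL1; rewrite negb_exists => /forallP/(_ (Ordinal st)).
  move: nL2; rewrite negb_exists => /forallP/(_ (Ordinal st)).
  have -> /= : driving w s (i : nat)%:Z by exact/asboolP.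
  set x := pos _ _ _ => h1 h2.
  have xn : (absz x < n)%N by have := ltn_ord i; lia.
  exists (Ordinal xn, s); split=> //=; first by rewrite -/x; lia.
  rewrite !inE; have := free_space Fs; rewrite -/x.
  by have {1}-> : x = absz x by lia.
have /choice[f fP] : forall i : 'I_n, exists p : 'I_n * nat, i \in B ->
    [/\ parkers (pos w) (prios w) (state_of w p.2).1 (state_of w p.2).2 p.2.+1 (i : nat)%:Z,
     pos w (i : nat)%:Z p.2.+1 = (p.1 : nat)%:Z & p.1 \in ~: C].
  move=> i; have [/parked[p pP]|_] := boolP (i \in B); first by exists p.
  by exists (i, 0).
have finj : {in B &, injective (fst \o f)}.
  move=> i j /fP[Pi xi _] /fP[Pj xj _] /= fij.
  have noFree s s' k k' : (s < s')%N ->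
      parkers (pos w) (prios w) (state_of w s).1 (state_of w s).2 s.+1 k ->
      parkers (pos w) (prios w) (state_of w s').1 (state_of w s').2 s'.+1 k' ->
      pos w k s.+1 <> pos w k' s'.+1.
    by move=> ss' Pk [_ Fk' _]; have [_ /(_ _ Pk)] := (freeS _ _ _ _ _).1 (free_le ss' Fk').
  have [ss|ss|ss] := ltngtP (f i).2 (f j).2.
  - by have := noFree _ _ _ _ ss Pi Pj; rewrite xi xj fij.
  - by have := noFree _ _ _ _ ss Pj Pi; rewrite xi xj fij.
  - rewrite ss in Pi xi; have := parkers_inj Pi Pj; rewrite xi xj fij.
    by move=> /(_ erefl) [] /val_inj.
rewrite -(card_in_imset finj); apply: subset_leq_card.
by apply/fintype.subsetP => _ /imsetP[i iB ->]; have [] := fP i iB.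
Qed.

(** Under resampling the excess is a simple random walk, so its averages solve the discrete heat
    equation with initial value [G]. *)
Lemma avg_excess (G : R -> R) z n a w (H : nat -> R -> R) :
    (forall a, H 0 a = G a) ->
    (forall n a, H n.+1 a = (H n (a + 1) + H n (a - 1)) / 2) ->
  avg (site_bits z n) (fun w => G (a + (excess w z n)%:~R)) w = H n a.
Proof.
move=> H0 HS; elim: n z a w => [|n IHn] z a w.
  by rewrite /= /excess big_ord0 addr0 H0.
have excessS w1 : excess w1 z n.+1 =
    (if cars w1 z then 1 else -1) + excess w1 (z + 1) n.
  rewrite /excess big_ord_recl /= addr0; congr (_ + _).
  by apply: eq_bigr => i _; rewrite (_ : z + _ = z + 1 + i%:Z) //= /bump; lia.
have key w1 : avg (site_bits (z + 1) n) (fun w => G (a + (excess w z n.+1)%:~R)) w1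
    = if cars w1 z then H n (a + 1) else H n (a - 1).
  pose d : R := if cars w1 z then 1 else - 1.
  transitivity (H n (a + d)); last by rewrite /d; case: ifP.
  rewrite -(IHn (z + 1) (a + d) w1).
  have Qcl k w' : k \in site_bits (z + 1) n -> cars w' z = cars w1 z ->
      cars (flip k w') z = cars w1 z.
    by move=> /site_bitsP[y yz ->] /=; have -> : (z == y) = false by lia.
  apply/eqP; rewrite eq_le; apply/andP; split;
    apply: (avg_le_on Qcl) => // w' e;
    by rewrite excessS intrD e addrA /d; case: (cars w1 z).
rewrite /= /avg1 !key HS /= eqxx; case: (cars w z) => //=.
by rewrite addrC.
Qed.

(* |s| >= s^2 / m - s^4 / (4 m^3) with m = sqrt n, then the second and fourth
   moments of simple random walk. *)
Lemma avg_excess_pos n w : (0 < n)%N ->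
  Num.sqrt n%:R / 8 <=
  avg (site_bits 0 n) (fun w => Num.max 0 (excess w 0 n)%:~R) w.
Proof.
move=> n0; set m := Num.sqrt n%:R.
have m0 : 0 < m by rewrite sqrtr_gt0 ltr0n.
have m2 : m ^+ 2 = n%:R by rewrite sqr_sqrtr.
pose G (s : R) := (s + (s ^+ 2 / m - s ^+ 4 / (4 * m ^+ 3))) / 2.
have GM s : G s <= Num.max 0 s.
  apply: le_trans (_ : (s + `|s|) / 2 <= _); last first.
    by have [s0|s0] := leP 0 s; [rewrite ger0_norm|rewrite ltr0_norm]; lra.
  rewrite /G ler_pM2r // lerD2l -[s ^+ 4]/(s ^+ (2 * 2)) exprM.
  rewrite -[s ^+ 2]real_normK ?num_real //; set y := `|s|.
  have y0 : 0 <= y by exact: normr_ge0.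
  rewrite -subr_ge0.
  have -> : y - (y ^+ 2 / m - y ^+ 2 ^+ 2 / (4 * m ^+ 3)) =
    y * (4 * m ^+ 3 - 4 * m ^+ 2 * y + y ^+ 3) / (4 * m ^+ 3).
    by field; rewrite gt_eqF.
  apply: divr_ge0; last by rewrite mulr_ge0 // exprn_ge0 // ltW.
  apply: mulr_ge0 => //.
  (* With [a = 6m/5] the product is [y^3 - 3 a^2 y + 2 a^3], where [3 a^2 >= 4 m^2] and
     [2 a^3 <= 4 m^3]. *)
  have : 0 <= (y - 6 / 5 * m) ^+ 2 * (y + 12 / 5 * m).
    apply: mulr_ge0; [exact: sqr_ge0|move: y0 m0; lra].
  have : 0 <= m ^+ 3 by rewrite exprn_ge0 ?ltW.
  have : 0 <= m ^+ 2 * y by rewrite mulr_ge0 ?sqr_ge0.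
  lra.
apply: le_trans (avg_le _ (f := fun w => G (0 + (excess w 0 n)%:~R)) _ w); last first.
  by move=> w'; rewrite add0r; exact: GM.
(* The mean of [G] at [a] plus a [k]-step walk, whose second moment is [a^2 + k] and fourth moment
   [a^4 + 6 a^2 k + 3 k^2 - 2 k]. *)
pose H k (a : R) := (a + ((a ^+ 2 + k%:R) / m -
  (a ^+ 4 + 6 * a ^+ 2 * k%:R + 3 * k%:R ^+ 2 - 2 * k%:R) / (4 * m ^+ 3))) / 2.
rewrite (@avg_excess G 0 n 0 w H); last first.
- by move=> k a; rewrite /H -[k.+1%:R]natr1; field; rewrite gt_eqF.
- by move=> a; rewrite /H /G; field; rewrite gt_eqF.
rewrite /H -m2 -subr_ge0.
have -> : (0 + ((0 ^+ 2 + m ^+ 2) / m - (0 ^+ 4 + 6 * 0 ^+ 2 * m ^+ 2 +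
    3 * (m ^+ 2) ^+ 2 - 2 * m ^+ 2) / (4 * m ^+ 3))) / 2 - m / 8 = (4 * m)^-1.
  by field; rewrite gt_eqF.
by rewrite invr_ge0 mulr_ge0 // ltW.
Qed.

End Balance.

(** * Invariance of the law *)

HB.instance Definition _ (R : realType) := gen_eqMixin (config R).
HB.instance Definition _ (R : realType) := gen_choiceMixin (config R).
HB.instance Definition _ (R : realType) := isPointed.Build (config R)
  (Config (fun=> false) (fun _ _ => false) (fun _ _ => 0)).

Section CanonicalSpace.
Variable R : realType.
Local Open Scope ereal_scope.

(* The value of a source of randomness, bits being coded as reals. *)
Definition val (k : source) (w : config R) : R :=
  match k with
  | inl (inl v) => (cars w v)%:R
  | inl (inr vn) => (coins w vn.1 vn.2)%:R
  | inr vs => prios w vs.1 vs.2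
  end.

Definition cylinder (J : {fset source}) (A : source -> set R) : set (config R) :=
  \bigcap_(k in [set` J]) val k @^-1` A k.

Definition cylinders : set (set (config R)) :=
  [set C | exists J A, (forall k, measurable (A k)) /\ C = cylinder J A].

Definition canonical := g_sigma_algebraType cylinders.

Lemma setI_closed_cylinders : setI_closed cylinders.
Proof.
move=> _ _ [J [A [mA ->]]] [J' [A' [mA' ->]]].
exists (J `|` J')%fset, (fun k => (if k \in J then A k else setT) `&`
  (if k \in J' then A' k else setT)); split.
  by move=> k; apply: measurableI; case: ifP.
rewrite seteqP; split=> w /=.
  by move=> [h h'] k _; split; case: ifP => // kJ; [exact: h|exact: h'].
move=> h; split=> k kJ; have [|] := h k; rewrite /= ?inE ?(kJ : k \in _) ?orbT //.
Qed.

Lemma measurable_cylinder J A : (forall k, measurable (A k)) ->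
  measurable (cylinder J A : set canonical).
Proof. by move=> mA; apply: sub_sigma_algebra; exists J, A. Qed.

Lemma measurable_val k : measurable_fun setT (val k : canonical -> R).
Proof.
move=> _ B mB; rewrite setTI.
have -> : val k @^-1` B = cylinder [fset k]%fset (fun=> B).
  rewrite seteqP; split=> w /=; first by move=> wB k' /fset1P ->.
  by apply; exact: fset11.
exact: measurable_cylinder.
Qed.

Definition source_law (k : source) (A : set R) : \bar R :=
  if k is inl _ then bernoulli_prob 2^-1 ((fun b : bool => b%:R : R) @^-1` A)
  else uniform_prob (@ltr01 R) A.

Definition parking_law (mu : set canonical -> \bar R) :=
  forall J A, (forall k, measurable (A k)) ->
    mu (cylinder J A) = \prod_(k <- J) source_law k (A k).

(** Cylinders form a pi-system generating the sigma-algebra, so invariance of the law need only be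
    checked on them. *)
Lemma parking_law_unique (mu nu : probability canonical R) :
  parking_law mu -> parking_law nu -> forall A, measurable A -> mu A = nu A.
Proof.
move=> lmu lnu A mA; apply: (@measure_unique _ R canonical cylinders (fun=> setT)) => //.
- exact: setI_closed_cylinders.
- move=> _; exists fset0, (fun=> setT); split=> [//|].
  by rewrite seteqP; split.
- by rewrite seteqP; split=> // w _; exists 0%N.
- by move=> _ [J [B [mB ->]]]; exact: etrans (lmu J B mB) (esym (lnu J B mB)).
- by move=> _; exact: le_lt_trans (probability_le1 mu measurableT) (ltry 1).
Qed.

Lemma measurable_to_canonical d (T : measurableType d) (Z : T -> canonical) :
  (forall k, measurable_fun setT (val k \o Z)) -> measurable_fun setT Z.
Proof.
move=> mZ; apply: (@measurability _ _ T canonical setT Z cylinders) => // _ [_ [J [A [mA ->]]] <-].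
rewrite setTI /cylinder preimage_bigcap.
apply: fin_bigcap_measurable; first exact: finite_fset.
by move=> k _; have := mZ k measurableT _ (mA k); rewrite setTI.
Qed.

Definition shift (a : int) (w : canonical) : canonical :=
  Config (fun v => cars w (v + a)) (fun v => coins w (v + a))
         (fun v => prios w (v + a)).

Definition shift_source (a : int) (k : source) : source :=
  match k with
  | inl (inl v) => inl (inl (v + a)%R)
  | inl (inr vn) => inl (inr ((vn.1 + a)%R, vn.2))
  | inr vs => inr ((vs.1 + a)%R, vs.2)
  end.

Lemma val_shift a k w : val k (shift a w) = val (shift_source a k) w.
Proof. by case: k => [[v|[v n]]|[v s]]. Qed.

Lemma val_flip (k0 : int + int * nat) k (w : canonical) :
  val k (flip k0 w) = if k == inl k0 then (1 - val k w)%R else val k w.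
Proof.
case: k0 k => [v0|[v0 n0]] [[v|[v n]]|[v s]] //=.
- rewrite -[inl (inl v) == _]/(v == v0); case: eqP => //= _.
  by case: (cars w v); rewrite /= ?subrr ?subr0.
- rewrite -[inl _ == _]/((v, n) == (v0, n0)); case: eqP => //= _.
  by case: (coins w v n); rewrite /= ?subrr ?subr0.
Qed.

Lemma measurable_shift a : measurable_fun setT (shift a).
Proof.
apply: measurable_to_canonical => k.
rewrite (_ : _ \o _ = val (shift_source a k)); first exact: measurable_val.
by apply/funext => w; rewrite /= val_shift.
Qed.

Lemma measurable_flip k0 : measurable_fun setT (flip k0 : canonical -> canonical).
Proof.
apply: measurable_to_canonical => k.
rewrite (_ : _ \o _ = fun w => if k == inl k0 then (1 - val k w)%R else val k w).
  by case: (k == inl k0); [apply: measurable_funB => //|]; exact: measurable_val.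
by apply/funext => w; rewrite /= val_flip.
Qed.

(** [source_law] does not depend on the site, so relabelling the sources of a cylinder keeps the
    product. *)
Lemma parking_law_shift a (mu : set canonical -> \bar R) :
  parking_law mu -> parking_law (pushforward mu (shift a)).
Proof.
move=> lmu J A mA; rewrite /pushforward.
have sK : cancel (shift_source a) (shift_source (- a)).
  by case=> [[v|[v n]]|[v s]] /=; rewrite addrK.
have sK' : cancel (shift_source (- a)) (shift_source a).
  by case=> [[v|[v n]]|[v s]] /=; rewrite subrK.
have -> : shift a @^-1` cylinder J A =
    cylinder [fset shift_source a k | k in J]%fset (A \o shift_source (- a)).
  rewrite seteqP; split=> w h k /=.
    move=> /imfsetP[k' k'J ->]; rewrite sK -val_shift; exact: h.
  move=> kJ; rewrite val_shift; have := h (shift_source a k).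
  by rewrite /= sK; apply; apply/imfsetP; exists k.
rewrite lmu; last by move=> k; exact: mA.
rewrite big_imfset /=; last by move=> k k' _ _; exact: (can_inj sK).
by apply: eq_bigr => k _; rewrite sK; case: k => [[v|[v n]]|[v s]].
Qed.

Lemma fair_coinE (A : set bool) :
  bernoulli_prob (2^-1 : R) A = 2^-1%:E * \d_true A + 2^-1%:E * \d_false A.
Proof.
rewrite bernoulli_probE; last by rewrite invr_ge0 ler0n invf_le1 ?ltr0n // ler1n.
by have -> : unstable.onem (2^-1 : R) = 2^-1%R by rewrite /unstable.onem; field.
Qed.

(** A flip turns a coded bit [x] into [1 - x], and a fair bit is symmetric; for the bits B^v this is
    where [p = 1/2] enters. *)
Lemma parking_law_flip k0 (mu : set canonical -> \bar R) :
  parking_law mu -> parking_law (pushforward mu (flip k0 : canonical -> canonical)).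
Proof.
move=> lmu J A mA; rewrite /pushforward.
pose A' k := if k == inl k0 then (fun x => 1 - x)%R @^-1` A k else A k.
have -> : flip k0 @^-1` cylinder J A = cylinder J A'.
  rewrite seteqP; split=> w h k kJ; have := h k kJ; rewrite /A' /= val_flip;
  by case: ifP.
rewrite lmu; last first.
  move=> k; rewrite /A'; case: ifP => // _; rewrite -[X in measurable X]setTI.
  by apply: measurable_funB.
apply: eq_bigr => k _; rewrite /A'; case: eqP => // -> /=.
rewrite !fair_coinE [in RHS]addeC !diracE.
by congr (_ * _%:R%:E + _ * _%:R%:E); congr nat_of_bool; apply/idP/idP;
  rewrite !inE /= ?subrr ?subr0.
Qed.

End CanonicalSpace.

(** * Measurability of the dynamics *)

Section MeasurableEvents.
Variable R : realType.
Local Notation canonical := (canonical R).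

Lemma measurable_exists (I : countType) (E : I -> set canonical) :
  (forall i, measurable (E i)) -> measurable [set w | exists i, E i w].
Proof.
move=> mE; rewrite (_ : [set _ | _] = \bigcup_i E i).
  by apply: countable_bigcupT_measurable => //; exact: countableP.
by rewrite seteqP; split=> w [i]; [exists i|move=> _ ?; exists i].
Qed.

Lemma measurable_forall (I : countType) (E : I -> set canonical) :
  (forall i, measurable (E i)) -> measurable [set w | forall i, E i w].
Proof.
move=> mE; rewrite (_ : [set _ | _] = ~` [set w | exists i, (~` E i) w]).
  apply: measurableC; apply: measurable_exists => i; exact: measurableC.
rewrite seteqP; split=> w /=; first by move=> h [i]; apply.
by move=> h i; apply: contrapT => nE; apply: h; exists i.
Qed.

Lemma measurable_car v : measurable [set w : canonical | cars w v].
Proof.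
have := @measurable_val R (inl (inl v)) measurableT _ (measurable_set1 1).
rewrite setTI; congr measurable; rewrite seteqP; split=> w /=.
  by move=> /eqP; rewrite pnatr_eq1 eqb1.
by move=> ->.
Qed.

Lemma measurable_coin v n : measurable [set w : canonical | coins w v n].
Proof.
have := @measurable_val R (inl (inr (v, n))) measurableT _ (measurable_set1 1).
rewrite setTI; congr measurable; rewrite seteqP; split=> w /=.
  by move=> /eqP; rewrite pnatr_eq1 eqb1.
by move=> ->.
Qed.

Lemma measurable_prio_lt v v' s :
  measurable [set w : canonical | prios w v s < prios w v' s].
Proof.
have := measurable_fun_ltr (@measurable_val R (inr (v, s)))
  (@measurable_val R (inr (v', s))) measurableT (I : measurable [set true]).
by rewrite setTI.
Qed.

Lemma measurable_prio_eq v v' s :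
  measurable [set w : canonical | prios w v s = prios w v' s].
Proof.
rewrite (_ : [set _ | _] = ~` ([set w | prios w v s < prios w v' s] `|`
                               [set w | prios w v' s < prios w v s])).
  by apply: measurableC; apply: measurableU; exact: measurable_prio_lt.
rewrite seteqP; split=> w /=; first by move=> ->; rewrite ltxx => -[].
by move=> /not_orP[/negP a /negP b]; apply/eqP; rewrite eq_le !leNgt a b.
Qed.

Lemma measurable_pos v n z : measurable [set w : canonical | pos w v n = z].
Proof.
elim: n z => [|n IHn] z.
  have [e|ne] := eqVneq v z.
    by rewrite (_ : [set _ | _] = setT) // seteqP; split=> w //= _; rewrite pos0.
  rewrite (_ : [set _ | _] = set0) // seteqP; split=> w //=.
  by rewrite pos0 => /eqP; rewrite (negPf ne).
rewrite (_ : [set _ | _] =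
  ([set w | coins w v n] `&` [set w | pos w v n = z - 1]) `|`
  (~` [set w | coins w v n] `&` [set w | pos w v n = z + 1])).
  by apply: measurableU; apply: measurableI => //; try apply: measurableC;
    exact: measurable_coin.
rewrite seteqP; split=> w /=; rewrite posS.
  by case: ifP => cw <-; [left|right]; split => //; lia.
by case=> -[] cw ->; [rewrite cw|move/negP/negPf: cw => ->]; lia.
Qed.

Lemma measurable_state n :
  (forall v, measurable [set w : canonical | (state_of w n).1 v]) /\
  (forall y, measurable [set w : canonical | (state_of w n).2 y]).
Proof.
elim: n => [|n [mD mF]].
  split=> v; first exact: measurable_car.
  rewrite (_ : [set _ | _] = ~` [set w | cars w v]).
    by apply: measurableC; exact: measurable_car.
  by rewrite seteqP; split=> w /negP.
pose N (w : canonical) := parkers (pos w) (prios w) (state_of w n).1 (state_of w n).2 n.+1.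
(* An event evaluated at a random site is a countable union over the values of that site. *)
have meet v (E : int -> set canonical) : (forall z, measurable (E z)) ->
    measurable [set w : canonical | E (pos w v n.+1) w].
  move=> mE; rewrite (_ : [set _ | _] =
    [set w | exists z, ([set w | pos w v n.+1 = z] `&` E z) w]).
    by apply: measurable_exists => z; apply: measurableI => //; exact: measurable_pos.
  rewrite seteqP; split=> w /=; last by case=> z [->].
  by move=> h; exists (pos w v n.+1).
have mN v : measurable [set w : canonical | N w v].
  rewrite (_ : [set _ | _] = [set w | (state_of w n).1 v] `&`
    ([set w | (state_of w n).2 (pos w v n.+1)] `&`
     [set w | forall v', ~ ([set w | (state_of w n).1 v'] `&` [set w | v' <> v] `&`
       [set w | pos w v' n.+1 = pos w v n.+1] `&`
       ~` [set w | prios w v n.+1 < prios w v' n.+1]) w])).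
    apply: measurableI => //; apply: measurableI.
      exact: (meet v (fun z => [set w | (state_of w n).2 z])).
    apply: measurable_forall => v'; apply: measurableC.
    apply: measurableI; last by apply: measurableC; exact: measurable_prio_lt.
    apply: measurableI.
      apply: measurableI => //; have [e|e] := pselect (v' <> v).
        by rewrite (_ : [set _ | _] = setT) // seteqP; split.
      by rewrite (_ : [set _ | _] = set0) // seteqP; split.
    apply: (meet v (fun z => [set w | pos w v' n.+1 = z])) => z.
    exact: measurable_pos.
  rewrite seteqP; split=> w.
    move=> [Dv Fv h]; split=> //; split=> // v' [[[Dv' /eqP v'v] xx]].
    by apply; exact: h.
  move=> [Dv [Fv h]]; split=> // v' Dv' v'v xx.
  by apply: contrapT => nl; apply: (h v'); split=> //; split=> //; split=> //; exact/eqP.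
split=> v.
  rewrite (_ : [set _ | _] = [set w | (state_of w n).1 v] `&` ~` [set w | N w v]).
    by apply: measurableI => //; exact: measurableC.
  by rewrite seteqP; split=> w /drivingS.
rewrite (_ : [set _ | _] = [set w | (state_of w n).2 v] `&`
  [set w | forall v', ~ ([set w | N w v'] `&` [set w | pos w v' n.+1 = v]) w]).
  apply: measurableI => //; apply: measurable_forall => v'; apply: measurableC.
  by apply: measurableI => //; exact: measurable_pos.
rewrite seteqP; split=> w.
  by move=> /freeS[Fv h]; split=> // v' [Nv']; exact: h.
by move=> [Fv h]; apply/freeS; split=> // v' Nv' xv; apply: (h v').
Qed.

Lemma measurable_driving s v : measurable [set w : canonical | driving w s v].
Proof.
have := (measurable_state s).1 v; congr measurable.
by rewrite seteqP; split=> w /asboolP.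
Qed.

Lemma measurable_reaches t v j : measurable [set w : canonical | reaches w t v j].
Proof.
rewrite (_ : [set _ | _] = [set w | exists s : 'I_t,
  ([set w | driving w s v] `&` [set w | exists z : int,
    ([set w | pos w v s.+1 = z] `&` [set w | j%:Z <= `|z - v|]) w]) w]).
  apply: measurable_exists => s; apply: measurableI; first exact: measurable_driving.
  apply: measurable_exists => z; apply: measurableI; first exact: measurable_pos.
  have [h|/negP h] := boolP (j%:Z <= `|z - v|).
    by rewrite (_ : [set _ | _] = setT) // seteqP; split.
  by rewrite (_ : [set _ | _] = set0) // seteqP; split.
rewrite seteqP; split=> w /=.
  by move=> /existsP[s /andP[ds js]]; exists s; split=> //; exists (pos w v s.+1).
by move=> [s [ds [z [<- js]]]]; apply/existsP; exists s; rewrite ds.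
Qed.

End MeasurableEvents.

(** * Means *)

Section Means.
Variable R : realType.
Local Notation canonical := (canonical R).
Local Open Scope ereal_scope.

Lemma uniform_prob_le (a b : R) : (a <= b)%R ->
  uniform_prob (@ltr01 R) `[a, b[ <= (b - a)%:E.
Proof.
move=> ab; rewrite /uniform_prob.
apply: (@le_trans _ _ (\int[lebesgue_measure]_(x in `[a, b[) 1)).
  apply: ge0_le_integral => //=.
  - by move=> x _; rewrite lee_fin uniform_pdf_ge0.
  - by apply/measurable_EFinP/measurable_funTS; exact: measurable_uniform_pdf.
  - move=> x _; rewrite lee_fin /uniform_pdf subr0 invr1.
    by case: ifP.
rewrite integral_cst //= mul1e lebesgue_measure_itv /= lte_fin.
by case: ltP => // ba; rewrite lee_fin subr_ge0.
Qed.

HB.instance Definition _ (a : int) := isMeasurableFun.Build _ _ canonical canonical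
  (@shift R a) (@measurable_shift R a).

Definition cflip (k : int + int * nat) : canonical -> canonical := flip k.

HB.instance Definition _ k := isMeasurableFun.Build _ _ canonical canonical
  (cflip k) (@measurable_flip R k).

Variable mu : probability canonical R.
Hypothesis lmu : parking_law mu.

Lemma prob_shift a A : measurable A -> mu (shift a @^-1` A) = mu A.
Proof.
move=> mA.
by have := parking_law_unique
  (mu := distribution mu (@shift R a)) (parking_law_shift a lmu) lmu mA.
Qed.

Lemma distribution_flip k A : measurable A -> distribution mu (cflip k) A = mu A.
Proof.
move=> mA.
by have := parking_law_unique
  (mu := distribution mu (cflip k)) (parking_law_flip k lmu) lmu mA.
Qed.

(** Cut the line into cells of length [1/(m+1)]. A tie puts two independent priorities into one
    cell, with probability at most [(m+2)/(m+1)^2]; the cells are half-open, so one extra cell is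
    needed to cover the value 1. *)
Lemma prob_tie v v' s : v != v' ->
  mu [set w : canonical | prios w v s = prios w v' s] = 0.
Proof.
move=> vv'; set E := [set _ | _].
have mE : measurable E by exact: measurable_prio_eq.
pose k : source := inr (v, s); pose k' : source := inr (v', s).
have kk' : k != k' by rewrite -[k == k']/((v, s) == (v', s)) xpair_eqE negb_and vv'.
have key (m : nat) : mu E <= (2 / m.+1%:R)%:E.
  pose a j : R := (j%:R / m.+1%:R)%R.
  have aS j : (a j.+1 - a j = m.+1%:R^-1)%R.
    by rewrite /a -[j.+1%:R]natr1 mulrDl mul1r addrC addKr.
  have aE j : (a j * m.+1%:R = j%:R)%R by rewrite divfK // pnatr_eq0.
  pose B (j : nat) : set R := `[a j, a j.+1[%classic.
  pose Q (j : nat) : set canonical := cylinder [fset k; k']%fset (fun=> B j).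
  have mQ j : measurable (Q j).
    by apply: measurable_cylinder => _; exact: measurable_itv.
  have QE j : mu (Q j) <= (m.+1%:R^-1 ^+ 2)%:E.
    rewrite lmu; last by move=> _; exact: measurable_itv.
    rewrite big_fsetU1 ?inE //= big_seq_fset1 expr2 EFinM.
    have Bj : uniform_prob (@ltr01 R) (B j) <= (m.+1%:R^-1)%:E.
      rewrite -(aS j); apply: uniform_prob_le.
      by rewrite -subr_ge0 aS invr_ge0.
    by apply: lee_pmul => //; exact: measure_ge0.
  pose O : set canonical := cylinder [fset k]%fset (fun=> ~` `[0%R, 1%R]%classic).
  have mO : measurable O.
    by apply: measurable_cylinder => _; apply: measurableC; exact: measurable_itv.
  have O0 : mu O = 0.
    rewrite lmu; last by move=> _; apply: measurableC; exact: measurable_itv.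
    rewrite big_seq_fset1 /= /uniform_prob integral_uniform_pdf setICl.
    by rewrite integral_set0.
  have EO : E `<=` O `|` \big[setU/set0]_(j < m.+2) Q j.
    move=> w /= e; have [x01|nx] := boolP (0 <= prios w v s <= 1)%R; last first.
      left=> k1; rewrite /= => /fset1P ->; rewrite /= in_itv /=; exact/negP.
    right; rewrite -bigcup_mkord; case/andP: x01 => x0 x1.
    have m0 : (0 < m.+1%:R :> R)%R by rewrite ltr0n.
    pose j := Num.truncn (prios w v s * m.+1%:R).
    have /andP[j1 j2] := Num.Theory.truncn_itv (mulr_ge0 x0 (ltW m0)).
    exists j.
      rewrite /= ltnS -(ler_nat R); apply: le_trans j1 _.
      by rewrite -[leRHS]mul1r ler_wpM2r // ltW.
    have xB : B j (prios w v s).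
      by rewrite /B /= in_itv /= /a ler_pdivrMr // ltr_pdivlMr // j1 j2.
    by move=> k1 /=; rewrite !inE => /orP[] /eqP -> //=; rewrite -e.
  have mQU : measurable (\big[setU/set0]_(j < m.+2) Q j).
    by apply: bigsetU_measurable.
  apply: le_trans (_ : mu (O `|` \big[setU/set0]_(j < m.+2) Q j) <= _).
    by apply: le_measure; rewrite ?inE //; exact: measurableU.
  apply: le_trans (_ : mu O + mu (\big[setU/set0]_(j < m.+2) Q j) <= _).
    exact: measureU2.
  rewrite O0 add0e.
  apply: le_trans (_ : \sum_(j < m.+2) mu (Q j) <= _).
    by apply: Boole_inequality => i _; exact: mQ.
  apply: le_trans (lee_sum _ (fun (i : 'I_m.+2) _ => QE i)) _.
  rewrite sumEFin sumr_const card_ord lee_fin -[leLHS]mulr_natl.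
  rewrite expr2 mulrA ler_wpM2r ?invr_ge0 // ler_pdivrMr ?ltr0n //.
  by rewrite -natrM ler_nat; lia.
apply/eqP; rewrite eq_le measure_ge0 andbT; apply/lee_addgt0Pr => e e0.
rewrite add0e; pose m := Num.truncn (2 / e).
apply: le_trans (key m) _; rewrite lee_fin ler_pdivrMr ?ltr0n //.
have := Num.Theory.truncnS_gt (2 / e); rewrite ltr_pdivrMr // mulrC; exact: ltW.
Qed.

Lemma negligible_tie : mu.-negligible [set w : canonical | ~ tiefree w].
Proof.
pose E (i : int * int * nat) : set canonical :=
  if i.1.1 == i.1.2 then set0 else [set w | prios w i.1.1 i.2 = prios w i.1.2 i.2].
have mE i : measurable (E i).
  by rewrite /E; case: ifP => // _; exact: measurable_prio_eq.
pose F n : set canonical := if choice.unpickle n is Some i then E i else set0.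
have F0 n : mu.-negligible (F n).
  rewrite /F; case: (choice.unpickle n) => [i|]; last exact: negligible_set0.
  apply/negligibleP => //; rewrite /E; case: ifPn; first by rewrite measure0.
  exact: prob_tie.
apply: negligibleS (negligible_bigcup F0) => w /= ntie.
apply: contrapT => nF; apply: ntie => s v v' vv'; apply/eqP => e; apply: nF.
exists (choice.pickle (v, v', s)); first exact: I.
by rewrite /F choice.pickleK /E /= (negPf vv').
Qed.

(** A relation, so that measurability, nonnegativity and finiteness of the integral travel
    together. *)
Definition mean (f : config R -> R) (e : R) : Prop :=
  [/\ measurable_fun setT (f : canonical -> R), (forall w, 0 <= f w)%R &
      \int[mu]_(w in [set: canonical]) (f w)%:E = e%:E].

Lemma mean_cst c : (0 <= c)%R -> mean (fun=> c) c.
Proof.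
move=> c0; split=> //.
rewrite integral_cst // -[RHS]mule1; congr (_ * _); exact: probability_setT.
Qed.

Lemma mean_indic (p : config R -> bool) : measurable [set w : canonical | p w] ->
  mean (fun w => (p w)%:R) (fine (mu [set w : canonical | p w])).
Proof.
move=> mp; have pE : (fun w : canonical => (p w)%:R : R) = \1_[set w | p w].
  by apply/funext => w; rewrite indicE; congr (nat_of_bool _)%:R; apply/idP/idP;
    rewrite inE.
split; [|by move=> w; rewrite ler0n|].
  by rewrite pE; exact: measurable_indic.
under eq_integral => w _ do rewrite -[(p w)%:R]/((fun w => (p w)%:R) w) pE.
by rewrite integral_indic // setIT fineK // fin_num_measure.
Qed.

Lemma mean_scale c f e : (0 <= c)%R -> mean f e -> mean (fun w => c * f w)%R (c * e).
Proof.
move=> c0 [mf f0 fe]; split.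
- exact: measurable_funM.
- by move=> w; rewrite mulr_ge0.
- under eq_integral => w _ do rewrite EFinM.
  rewrite ge0_integralZl_EFin ?fe //.
    by move=> w _; rewrite lee_fin.
  exact/measurable_EFinP.
Qed.

Lemma mean_add f g e e' : mean f e -> mean g e' -> mean (fun w => f w + g w)%R (e + e').
Proof.
move=> [mf f0 fe] [mg g0 ge]; split.
- exact: measurable_funD.
- by move=> w; rewrite addr_ge0.
- under eq_integral => w _ do rewrite EFinD.
  rewrite ge0_integralD ?fe ?ge //; try (by move=> w _; rewrite lee_fin);
  exact/measurable_EFinP.
Qed.

Lemma mean_sum (I : Type) (r : seq I) (f : I -> config R -> R) e :
  (forall i, mean (f i) (e i)) ->
  mean (fun w => \sum_(i <- r) f i w)%R (\sum_(i <- r) e i)%R.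
Proof.
move=> fe; elim: r => [|i r IHr].
  rewrite big_nil (_ : (fun w => _) = fun=> 0%R); first exact: mean_cst.
  by apply/funext => w; rewrite big_nil.
rewrite big_cons (_ : (fun w => _) = fun w => f i w + \sum_(j <- r) f j w)%R.
  exact: mean_add.
by apply/funext => w; rewrite big_cons.
Qed.

Lemma mean_flip k f e : mean f e -> mean (f \o flip k) e.
Proof.
move=> [mf f0 fe]; split.
- exact: measurableT_comp mf (@measurable_flip R k).
- by move=> w; exact: f0.
- rewrite -fe.
  transitivity (\int[distribution mu (cflip k)]_(w in [set: canonical]) (f w)%:E).
    by rewrite ge0_integral_distribution //; exact/measurable_EFinP.
  by apply: (eq_measure_integral mu) => A mA _; exact: distribution_flip.
Qed.

(** Each flip preserves the law. Through this lemma the pointwise bounds on [avg] become bounds on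
    expectations. *)
Lemma mean_avg K f e : mean f e -> mean (avg K f) e.
Proof.
move=> fe; elim: K => [//|k K IHK] /=.
have := mean_scale (c := 2^-1%R) _ (mean_add IHK (mean_flip k IHK)).
rewrite (_ : 2^-1 * (e + e) = e)%R; last by field.
rewrite (_ : avg1 _ _ = fun w => 2^-1 * (avg K f w + (avg K f \o flip k) w))%R.
  by apply; rewrite invr_ge0.
by apply/funext => w; rewrite /avg1 mulrC.
Qed.

Lemma le_mean f g e e' : (forall w, tiefree w -> f w <= g w)%R ->
  mean f e -> mean g e' -> (e <= e')%R.
Proof.
move=> fg [mf f0 fe] [mg g0 ge]; rewrite -lee_fin -fe -ge.
apply: ae_ge0_le_integral => //; try (by move=> w _; rewrite lee_fin);
  try exact/measurable_EFinP.
apply: negligibleS negligible_tie => w /= h tie; apply: h => _.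
by rewrite lee_fin fg.
Qed.

End Means.

(** * Truncated parking time as a count of driving times *)

Section ParkingTime.
Variable R : realType.

(** A car that parks at time [s + 1] is driving exactly at the [s + 1] times [0, ..., s]. *)
Lemma mine_parking_time (w : config R) (v : int) (t : nat) :
  mine (parking_time (cars w) (pos w) (prios w) v) t%:R%:E =
  (\sum_(s < t) (driving w s v)%:R)%:E.
Proof.
rewrite /parking_time; case: ifPn => cv; last first.
  rewrite big1; first by rewrite min_l // lee_fin.
  move=> s _; have -> // : driving w s v = false.
  by apply/negP => /asboolP /driving_car; apply/negP.
pose N s := parkers (pos w) (prios w) (state_of w s).1 (state_of w s).2 s.+1.
have ND s : N s v -> driving w s v /\ ~~ driving w s.+1 v.
  move=> Ns; split; first by apply/asboolP; case: Ns.
  by apply/asboolPn => /drivingS[].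
case: (boolP (driving w t v)) => [Dt|nDt].
  rewrite (eq_bigr (fun=> 1)); last first.
    by move=> s _; rewrite (drivingW (ltnW (ltn_ord s)) Dt).
  rewrite sumr_const card_ord min_r //; apply: le_ereal_inf_tmp => _ [_ [m -> /ND[_ nD]] <-].
  rewrite lee_fin ler_nat leqNgt; apply: contra nD => mt.
  exact: drivingW (ltnW mt) Dt.
have [s st Ns] := parked_time cv nDt; have [Ds nDs] := ND s Ns.
have -> : [set r%:R%:E | r in [set r | parks_at (cars w) (pos w) (prios w) v r]]
    = [set s.+1%:R%:E] :> set (\bar R).
  rewrite seteqP; split=> y /=; last by move=> ->; exists s.+1 => //; exists s.
  move=> [_ [m -> Nm] <-]; suff -> : m = s by [].
  have [Dm nDm] := ND m Nm; apply/eqP; rewrite eqn_leq; apply/andP; split.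
    by rewrite leqNgt; apply: contra nDs => ms; exact: drivingW Dm.
  by rewrite leqNgt; apply: contra nDm => ms; exact: drivingW Ds.
rewrite ereal_inf1 min_l ?lee_fin ?ler_nat //; congr _%:E.
rewrite (eq_bigr (fun r : 'I_t => (r < s.+1)%N%:R)); last first.
  move=> r _; congr (nat_of_bool _)%:R; apply/idP/idP => [Dr|rs].
    by rewrite ltnS leqNgt; apply: contra nDs => sr; exact: drivingW Dr.
  by apply: drivingW Ds; rewrite -ltnS.
rewrite -natr_sum; congr _%:R.
rewrite -[LHS]card_ord -sum1_card (big_ord_widen t (fun=> 1%N) st) big_mkcond.
by apply: eq_bigr => r _; case: (_ < _)%N.
Qed.

End ParkingTime.

(** * Transfer to an arbitrary probability space *)

Section CanonicalMap.
Context (d : measure_display) (T : measurableType d) (R : realType)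
  (P : probability T R) (D : parking_randomness P (2^-1 : R)).

Definition realization (w : T) : canonical R :=
  Config (fun v => car D v w) (fun v n => heads D v n w) (fun v s => prio D v s w).

Lemma measurable_realization : measurable_fun setT realization.
Proof.
apply: measurable_to_canonical => k.
have bm (X : {RV P >-> bool}) : measurable_fun setT (fun w => (X w)%:R : R).
  move=> _ B mB; rewrite setTI.
  rewrite (_ : _ @^-1` B = X @^-1` ((fun b : bool => b%:R) @^-1` B)) //.
  by rewrite -[X in measurable X]setTI; exact: measurable_funP.
case: k => [[v|[v n]]|[v s]]; [exact: bm|exact: bm|exact: measurable_funP].
Qed.

HB.instance Definition _ := isMeasurableFun.Build _ _ T (canonical R)
  realization measurable_realization.

Lemma parking_law_realization : parking_law (distribution P realization).
Proof.
move=> J A mA; rewrite /distribution /pushforward /cylinder preimage_bigcap.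
pose E k := realization @^-1` (val k @^-1` A k).
transitivity (\prod_(k <- J) P (E k))%E.
  apply: (@all_independent _ _ _ _ _ D J E) => k _.
  case: k @E => [[v|[v n]]|[v s]] E.
  - by exists ((fun b : bool => b%:R : R) @^-1` A (inl (inl v))); rewrite ?setTI.
  - by exists ((fun b : bool => b%:R : R) @^-1` A (inl (inr (v, n)))); rewrite ?setTI.
  - by exists (A (inr (v, s))); [exact: mA|rewrite setTI].
apply: eq_bigr => k _; case: k @E => [[v|[v n]]|[v s]] E.
- exact: (car_law D v (A := (fun b : bool => b%:R : R) @^-1` A (inl (inl v)))).
- exact: (heads_law D v n (A := (fun b : bool => b%:R : R) @^-1` A (inl (inr (v, n))))).
- exact: (prio_law D v s (mA (inr (v, s)))).
Qed.

Lemma expectation_min_tau (t : nat) :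
  ('E_P[fun w => fine (mine (tau D 0 w) t%:R%:E)])%E =
  (\sum_(s < t) fine (distribution P realization
     [set w : canonical R | driving w s 0]))%:E.
Proof.
have [mf f0 fe] := mean_sum (index_enum 'I_t)
  (fun s : 'I_t => mean_indic (distribution P realization) (@measurable_driving R s 0)).
rewrite -fe ge0_integral_distribution //; last exact/measurable_EFinP.
rewrite unlock; apply: eq_integral => w _ /=; congr _%:E.
by rewrite -[tau D 0 w]/(parking_time (cars (realization w)) (pos (realization w))
  (prios (realization w)) 0) mine_parking_time.
Qed.

End CanonicalMap.

(** * Rates *)

Section ShiftedDynamics.
Variable R : realType.
Implicit Types (w : canonical R) (a : int).

Lemma pos_shift a w v n : pos (shift a w) v n = pos w (v + a) n - a.
Proof. by rewrite /pos /= addrAC addrK. Qed.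

Lemma state_of_shift a w n :
  (forall v, (state_of (shift a w) n).1 v <-> (state_of w n).1 (v + a)) /\
  (forall y, (state_of (shift a w) n).2 y <-> (state_of w n).2 (y + a)).
Proof.
elim: n => [|n [ID IF]]; first by split.
have IN v : parkers (pos (shift a w)) (prios (shift a w)) (state_of (shift a w) n).1
      (state_of (shift a w) n).2 n.+1 v <->
    parkers (pos w) (prios w) (state_of w n).1 (state_of w n).2 n.+1 (v + a).
  split=> -[Dv Fv h]; split.
  - exact/ID.
  - by move: Fv; rewrite pos_shift => /IF; rewrite subrK.
  - move=> v' Dv' v'v xx; have := h (v' - a).
    rewrite !pos_shift /= subrK; apply; rewrite ?xx //; first exact/ID/(eq_ind_r _ Dv' (subrK _ _)).
    by rewrite subr_eq.
  - exact/ID.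
  - by rewrite pos_shift; apply/IF; rewrite subrK.
  - move=> v' /ID Dv' v'v; rewrite !pos_shift => /addIr; apply: h => //.
    by rewrite (inj_eq (addIr a)).
split=> y.
  split=> /drivingS[Dy nN]; apply/drivingS; split; try exact/ID.
    by move=> N; apply: nN; apply/IN.
  by move=> N; apply: nN; apply/IN.
split=> /freeS[Fy h]; apply/freeS; split; try exact/IF.
  move=> v Nv xv; apply: (h (v - a)); first by apply/IN; rewrite subrK.
  by rewrite pos_shift subrK xv addrK.
move=> v /IN Nv; rewrite pos_shift => xv; apply: (h _ Nv).
by rewrite -xv subrK.
Qed.

Lemma driving_shift a w n v : driving (shift a w) n v = driving w n (v + a).
Proof. by apply/asboolP/asboolP => /((state_of_shift a w n).1 v). Qed.

Lemma reaches_shift a w t v j : reaches (shift a w) t v j = reaches w t (v + a) j.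
Proof.
apply: eq_existsb => s; rewrite driving_shift pos_shift.
by congr (_ && (_ <= `|_|)); rewrite opprD addrA addrAC.
Qed.

End ShiftedDynamics.

Section Rates.
Variables (R : realType) (mu : probability (canonical R) R).
Hypothesis lmu : parking_law mu.

Definition survival (s : nat) : R :=
  fine (mu [set w : canonical R | driving w s 0]).

Definition reach_prob (t j : nat) : R :=
  fine (mu [set w : canonical R | reaches w t 0 j]).

Lemma mean_driving s v : mean mu (fun w => (driving w s v)%:R) (survival s).
Proof.
have := mean_indic mu (@measurable_driving R s v); congr mean; congr fine.
rewrite -[RHS](prob_shift lmu v); last exact: measurable_driving.
congr (mu _); rewrite seteqP; split=> w /=; by rewrite driving_shift add0r.
Qed.

Lemma mean_reaches t v j : mean mu (fun w => (reaches w t v j)%:R) (reach_prob t j).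
Proof.
have := mean_indic mu (@measurable_reaches R t v j); congr mean; congr fine.
rewrite -[RHS](prob_shift lmu v); last exact: measurable_reaches.
congr (mu _); rewrite seteqP; split=> w /=; by rewrite reaches_shift add0r.
Qed.

Lemma survival_ge0 s : 0 <= survival s.
Proof. by rewrite fine_ge0. Qed.

Lemma le_survival s s' : (s <= s')%N -> survival s' <= survival s.
Proof.
move=> ss'; apply: le_mean (mean_driving s' 0) (mean_driving s 0) => // w _.
rewrite ler_nat; case: (boolP (driving w s' 0)) => // h.
by rewrite (drivingW ss' h).
Qed.

Lemma survival_sum_le t l N : (t <= l ^ 2)%N ->
  N%:R * \sum_(s < t) survival s <=
  N%:R * (2 * l%:R * (1 + hit R l 1)) + (l + t.*2).+1%:R * t%:R.
Proof.
move=> tl; have [K KP] := avg_driving_time_le R N tl.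
have c0 : 0 <= N%:R * (2 * l%:R * (1 + hit R l 1)) + (l + t.*2).+1%:R * t%:R.
  by rewrite addr_ge0 ?mulr_ge0 ?addr_ge0 ?hit_ge0.
apply: (le_mean lmu KP _ (mean_cst mu c0)).
apply: mean_avg => //; rewrite mulr_sumr.
apply: mean_sum => s; rewrite mulr_natl -[N in _ *+ N]card_ord -sumr_const.
by apply: mean_sum => i; exact: mean_driving.
Qed.

Lemma reach_sum_le t n :
  \sum_(j < n) reach_prob t j.+1 <=
  1 + \sum_(s < t) 2 / Num.sqrt s.+1%:R * survival s.
Proof.
have [K KP] := avg_sum_reaches_le R 0 t n.
apply: (le_mean lmu (fun w _ => KP w)); apply: mean_avg => //.
  by apply: mean_sum => j; exact: mean_reaches.
apply: mean_add => //; first exact: mean_cst.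
apply: mean_sum => s; apply: mean_scale; first by rewrite divr_ge0 ?sqrtr_ge0.
exact: mean_driving.
Qed.

(** Mean of [excess_le]: by translation invariance the left exits and the right exits each run once
    through the levels [1, ..., n]. *)
Lemma survival_ge t n : (0 < n)%N ->
  Num.sqrt n%:R / 8 <= n%:R * survival t + 2 * \sum_(j < n) reach_prob t j.+1.
Proof.
move=> n0; set K := site_bits 0 n.
pose f (w : config R) : R := \sum_(i < n) (driving w t (i : nat)%:Z)%:R +
  (\sum_(i < n) (reaches w t (i : nat)%:Z i.+1)%:R +
   \sum_(i < n) (reaches w t (i : nat)%:Z (n - i))%:R).
have mf : mean mu (avg K f) (n%:R * survival t + 2 * \sum_(j < n) reach_prob t j.+1).
  apply: mean_avg => //; apply: mean_add.
    rewrite mulr_natl -[n in _ *+ n]card_ord -sumr_const.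
    by apply: mean_sum => i; exact: mean_driving.
  rewrite mulr_natl mulr2n; apply: mean_add.
    by apply: mean_sum => j; exact: mean_reaches.
  rewrite (reindex_inj rev_ord_inj) /=.
  apply: mean_sum => i; have -> : (n - i)%N = (n - i.+1).+1.
    by have := ltn_ord i; lia.
  exact: mean_reaches.
have c0 : 0 <= Num.sqrt n%:R / 8 :> R by rewrite divr_ge0 ?sqrtr_ge0.
apply: (le_mean lmu _ (mean_cst mu c0) mf) => w _.
apply: le_trans (avg_excess_pos w n0) _; apply: avg_le => w'.
rewrite ge_max; apply/andP; split.
  by rewrite !addr_ge0 // sumr_ge0.
have := excess_le w' t n; rewrite -(ler_int R) => /le_trans; apply.
rewrite -[leLHS]/((_ + _)%N%:R) natrD !natr_sum lerD2l -big_split /=.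
by apply: ler_sum => i _; rewrite natrD.
Qed.

End Rates.

(** * Fourth-root asymptotics with explicit constants *)

Section Asymptotics.
Variable R : realType.

Lemma nat_sqrt_exists (n : nat) :
  exists l : nat, (n <= l ^ 2)%N /\ l%:R <= Num.sqrt n%:R + 1 :> R.
Proof.
have s0 : 0 <= Num.sqrt n%:R :> R by exact: sqrtr_ge0.
have /andP[l1 l2] := Num.Theory.truncn_itv s0.
exists (Num.truncn (Num.sqrt n%:R : R)).+1; split; last by rewrite -natr1 lerD2r.
rewrite -(ler_nat R) natrX -[leLHS]sqr_sqrtr //; apply: lerXn2r (ltW l2) => //.
by rewrite nnegrE.
Qed.

Definition root4 (n : nat) : R := Num.sqrt (Num.sqrt n%:R).

Lemma root4_sqr n : root4 n ^+ 2 = Num.sqrt n%:R.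
Proof. by rewrite sqr_sqrtr ?sqrtr_ge0. Qed.

Lemma root4_exp4 n : root4 n ^+ 4 = n%:R.
Proof. by rewrite -[4%N]/(2 * 2)%N exprM root4_sqr sqr_sqrtr. Qed.

Lemma root4_ge1 n : (0 < n)%N -> 1 <= root4 n.
Proof. by move=> n0; rewrite -sqrtr1 -{1}sqrtr1 !ler_wsqrtr // ler1n. Qed.

Lemma powR_root4 n : n%:R `^ (3 / 4) = root4 n ^+ 3.
Proof.
have x0 : 0 <= root4 n by exact: sqrtr_ge0.
rewrite -root4_exp4 -!powR_mulrn // -powRrM; congr (_ `^ _).
by field.
Qed.

(** Telescoping: with [y] and [z] the fourth roots of [t + 1] and [t],
    [1 = y^4 - z^4 <= 4 y^3 (y - z)]. *)
Lemma sum_inv_root4_cube t : \sum_(s < t) (root4 s.+1 ^+ 3)^-1 <= 4 * root4 t.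
Proof.
elim: t => [|t IHt]; first by rewrite big_ord0 mulr_ge0 ?sqrtr_ge0.
rewrite big_ord_recr /=.
have y1 := root4_ge1 (ltn0Sn t); have z0 : 0 <= root4 t by exact: sqrtr_ge0.
have e : root4 t.+1 ^+ 4 - root4 t ^+ 4 = 1 by rewrite !root4_exp4 -natr1 addrAC subrr add0r.
have zy : root4 t <= root4 t.+1 by rewrite !ler_wsqrtr // ler_nat.
apply: le_trans (lerD IHt (lexx _)) _; rewrite -lerBrDl.
move: e zy y1 z0 {IHt}; set y := root4 t.+1; set z := root4 t => e zy y1 z0.
have y0 : 0 < y ^+ 3 by rewrite exprn_gt0 // (lt_le_trans ltr01).
rewrite -(ler_pM2r y0) mulVf ?gt_eqF // -[leLHS]e.
have -> : y ^+ 4 - z ^+ 4 = (y - z) * (y ^+ 3 + y ^+ 2 * z + y * z ^+ 2 + z ^+ 3) by ring.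
have -> : (4 * y - 4 * z) * y ^+ 3 = (y - z) * (y ^+ 3 + y ^+ 3 + y ^+ 3 + y ^+ 3) by ring.
have yy : 0 <= y by exact: le_trans z0 zy.
have z3 : z ^+ 3 <= y ^+ 3 by apply: lerXn2r zy; rewrite nnegrE.
have z2 : z ^+ 2 <= y ^+ 2 by apply: lerXn2r zy; rewrite nnegrE.
apply: ler_wpM2l; first by rewrite subr_ge0.
have h1 : y ^+ 2 * z <= y ^+ 3 by rewrite [leRHS]exprSr ler_wpM2l ?sqr_ge0.
have h2 : y * z ^+ 2 <= y ^+ 3 by rewrite [leRHS]exprS ler_wpM2l.
lra.
Qed.

Variable mu : probability (canonical R) R.
Hypothesis lmu : parking_law mu.
Local Notation q := (survival mu).

Lemma survival_sum_ub t : (0 < t)%N -> \sum_(s < t) q s <= 33 * root4 t ^+ 3.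
Proof.
move=> t0; have x1 := root4_ge1 t0; set x := root4 t in x1 *.
have x0 : 0 <= x by exact: le_trans x1.
have [l [tl lx]] := nat_sqrt_exists t; have [m [lm mx]] := nat_sqrt_exists l.
have x2 : 1 <= x ^+ 2 by rewrite exprn_ege1.
have {}lx : l%:R <= 2 * x ^+ 2 by move: lx; rewrite -root4_sqr -/x; lra.
have {}mx : m%:R <= 3 * x.
  apply: le_trans mx _; have : Num.sqrt l%:R <= 2 * x.
    rewrite -[leRHS]ger0_norm ?mulr_ge0 // -sqrtr_sqr ler_wsqrtr //.
    apply: le_trans lx _; rewrite exprMn; have := sqr_ge0 x; lra.
  lra.
(* With [N = t^2] the boundary term is at most 5 per car; the main term is at most [28 x^3], as [l]
   is of order [x^2] and [hit R l 1] of order [x]. *)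
have := survival_sum_le lmu (t ^ 2) tl.
have h1 : hit R l 1 <= 2 * (3 * x).
  by apply: le_trans (hit_le_sqrt R 1 lm) _; rewrite mulr1 ler_wpM2l.
have tE : t%:R = x ^+ 4 by rewrite root4_exp4.
have x3 : x ^+ 2 <= x ^+ 3 by exact: ler_weXn2l.
have x3' : 1 <= x ^+ 3 by rewrite exprn_ege1.
have x4 : x ^+ 2 <= x ^+ 4 by exact: ler_weXn2l.
have x4' : 1 <= x ^+ 4 by rewrite exprn_ege1.
have x8 : 0 < x ^+ 4 * x ^+ 4 by rewrite mulr_gt0 // (lt_le_trans ltr01).
have -> : (t ^ 2)%N%:R = x ^+ 4 * x ^+ 4 :> R by rewrite natrX tE.
have -> : (l + t.*2).+1%:R = l%:R + 2 * x ^+ 4 + 1 :> R.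
  by rewrite -natr1 natrD -muln2 natrM tE (mulrC 2).
rewrite tE => h; rewrite -(ler_pM2l x8); apply: le_trans h _.
have h2 : 2 * l%:R * (1 + hit R l 1) <= 4 * x ^+ 2 + 24 * x ^+ 3.
  apply: le_trans (_ : 2 * (2 * x ^+ 2) * (1 + 2 * (3 * x)) <= _).
    by apply: ler_pM; rewrite ?mulr_ge0 ?addr_ge0 ?hit_ge0 ?lerD2l ?ler_pM2l.
  by rewrite [x ^+ 3]exprSr; lra.
have h3 : (l%:R + 2 * x ^+ 4 + 1) * x ^+ 4 <= 5 * x ^+ 4 * x ^+ 4.
  by rewrite ler_wpM2r ?exprn_ge0 //; lra.
have h4 : x ^+ 4 * x ^+ 4 * (2 * l%:R * (1 + hit R l 1)) <=
    x ^+ 4 * x ^+ 4 * (28 * x ^+ 3).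
  by apply: (ler_wpM2l (ltW x8)); lra.
have h5 : x ^+ 4 * x ^+ 4 * 5 <= x ^+ 4 * x ^+ 4 * (5 * x ^+ 3).
  by apply: (ler_wpM2l (ltW x8)); lra.
lra.
Qed.

(** By monotonicity [(s + 1) q(s)] is at most the sum of [q] up to [s]. *)
Lemma survival_ub s : q s <= 33 / root4 s.+1.
Proof.
have y1 := root4_ge1 (ltn0Sn s); set y := root4 s.+1 in y1 *.
have y0 : 0 < y by exact: lt_le_trans y1.
have h : s.+1%:R * q s <= 33 * y ^+ 3.
  apply: le_trans (survival_sum_ub (ltn0Sn s)).
  rewrite (_ : _ * q s = \sum_(r < s.+1) q s); last by rewrite sumr_const card_ord mulr_natl.
  by apply: ler_sum => r _; apply: le_survival => //; rewrite -ltnS.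
rewrite ler_pdivlMr // -(ler_pM2r (exprn_gt0 3 y0)) -mulrA -exprS.
by rewrite root4_exp4 mulrC.
Qed.

Lemma reach_sum_ub t n : (0 < t)%N ->
  \sum_(j < n) reach_prob mu t j.+1 <= 265 * root4 t.
Proof.
move=> t0; have x1 := root4_ge1 t0.
apply: le_trans (reach_sum_le lmu t n) _.
apply: le_trans (_ : 1 + \sum_(s < t) 66 * (root4 s.+1 ^+ 3)^-1 <= _).
  rewrite lerD2l; apply: ler_sum => s _.
  have y0 : 0 < root4 s.+1 by exact: lt_le_trans (root4_ge1 (ltn0Sn s)).
  rewrite -root4_sqr.
  apply: le_trans (_ : 2 / root4 s.+1 ^+ 2 * (33 / root4 s.+1) <= _).
    by rewrite ler_wpM2l ?survival_ub // divr_ge0 ?sqr_ge0.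
  by rewrite le_eqVlt; apply/orP; left; apply/eqP; field; rewrite gt_eqF.
(* The constant is [265 = 1 + 66 * 4], with [1 <= root4 t]. *)
by rewrite -mulr_sumr; have := sum_inv_root4_cube t; lra.
Qed.

Lemma survival_lb t : (0 < t)%N -> (16 * (32 * 265 + 1))^-1 / root4 t <= q t.
Proof.
move=> t0; have x1 := root4_ge1 t0; set x := root4 t in x1 *.
have x0 : 0 < x by exact: lt_le_trans x1.
have A0 : 0 <= 32 * 265 * x by move: x0; lra.
(* For an interval of length [m^2] the excess gives [m/8]. As [m > 32 * 265 x], the exits take at
   most [2 * 265 x <= m/16], leaving [m/16] for the survivors. *)
pose m := (Num.truncn (32 * 265 * x)).+1.
have /andP[m1 m2] := Num.Theory.truncn_itv A0.
have {}m1 : m%:R <= (32 * 265 + 1) * x.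
  by rewrite /m -natr1; move: m1 x1; lra.
have m0 : 0 < m%:R :> R by rewrite ltr0n.
have := survival_ge lmu t (n := (m ^ 2)%N); rewrite expn_gt0 => /(_ isT).
rewrite natrX sqrtr_sqr ger0_norm ?ler0n // => h.
have := reach_sum_ub (m ^ 2) t0; rewrite -/x => h'.
have h2 : m%:R / 16 <= m%:R * (m%:R * q t).
  by rewrite mulrA -expr2; move: m2; rewrite -/m; lra.
have {}h2 : 16^-1 <= m%:R * q t by rewrite -(ler_pM2l m0).
have h3 : 16^-1 <= (32 * 265 + 1) * x * q t.
  by apply: le_trans h2 _; rewrite ler_wpM2r ?survival_ge0.
have B0 : 0 < 16 * (32 * 265 + 1) :> R by lra.
have : 1 <= q t * (16 * (32 * 265 + 1) * x) by move: h3; lra.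
move: (16 * _) B0 => B B0 h4.
by rewrite -invfM -div1r ler_pdivrMr ?mulr_gt0.
Qed.

Lemma survival_sum_lb t : (0 < t)%N ->
  (16 * (32 * 265 + 1))^-1 * root4 t ^+ 3 <= \sum_(s < t) q s.
Proof.
move=> t0; have x0 : 0 < root4 t by exact: lt_le_trans (root4_ge1 t0).
apply: le_trans (_ : t%:R * q t <= _); last first.
  rewrite mulr_natl -[t in _ *+ t]card_ord -sumr_const.
  by apply: ler_sum => s _; apply: le_survival => //; exact: ltnW.
apply: le_trans (_ : t%:R * ((16 * (32 * 265 + 1))^-1 / root4 t) <= _); last first.
  by rewrite ler_wpM2l ?survival_lb.
set k := (16 * _)^-1; rewrite -root4_exp4 le_eqVlt; apply/orP; left; apply/eqP.
by field; rewrite gt_eqF.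
Qed.

End Asymptotics.

Theorem theorem1p2 (R : realType) :
  exists C c : R, [/\ 0 < C, 0 < c &
    forall (d : measure_display) (T : measurableType d) (P : probability T R)
           (D : parking_randomness P (2^-1 : R)) (t : nat), (2 <= t)%N ->
      let Emin := ('E_P[fun w => fine (mine (tau D 0 w) t%:R%:E)])%E in
      ((c * (t%:R `^ (3 / 4)) * (ln t%:R `^ (- (1 / 4))))%:E <= Emin)%E /\
      (Emin <= (C * (t%:R `^ (3 / 4)))%:E)%E].
Proof.
(* [k] is the constant of [survival_sum_lb]; [e] normalizes the logarithmic factor so that it is at
   most 1 for all [t >= 2]. *)
pose k : R := (16 * (32 * 265 + 1))^-1; pose e : R := ln 2 `^ (1 / 4).
have l2 : 0 < ln 2 :> R by rewrite ln_gt0 // ltr1n.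
have e0 : 0 < e by rewrite powR_gt0.
have k0 : 0 < k by rewrite invr_gt0; lra.
exists 33, (k * e); split; [by []|exact: mulr_gt0|].
move=> d T P D t t2 Emin; have t0 : (0 < t)%N by exact: ltnW.
have lmu := parking_law_realization D.
rewrite /Emin expectation_min_tau powR_root4 !lee_fin; split; last first.
  exact: survival_sum_ub.
apply: le_trans (survival_sum_lb lmu t0); rewrite -/k.
have lt2 : ln 2 <= ln t%:R :> R by rewrite ler_ln ?posrE ?ltr0n // ler_nat.
have h : e * ln t%:R `^ (- (1 / 4)) <= 1.
  have lt0 : 0 < ln t%:R :> R by exact: lt_le_trans lt2.
  rewrite powRN ler_pdivrMr ?powR_gt0 // [leRHS]mul1r /e.
  by apply: (@ge0_ler_powR _ (1 / 4) _ (ln 2) _ _ _ lt2);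
    rewrite ?nnegrE ?divr_ge0 ?(ltW l2) ?(ltW lt0).
have x3 : 0 <= k * root4 R t ^+ 3.
  by rewrite mulr_ge0 ?(ltW k0) // exprn_ge0 // sqrtr_ge0.
by rewrite (mulrAC k e) -[leLHS]mulrA -[leRHS]mulr1 ler_wpM2l.
Qed.
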